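(* For all positive integers $k,p,r$ with $p<2\lfloor\sqrt k\rfloor$, there exists a $k$-plane graph $G$ that has a unique minimum vertex cut $S$, with $|S|=p$, such that $d_F(s_1,s_2)\ge r$ in $\Lambda(G)$ for any two distinct vertices $s_1,s_2\in S$.
   Context: A drawing of a graph maps the vertices to distinct points of the plane and each edge to a curve (a homeomorphic image of $[0,1]$) joining the images of its endpoints whose interior contains no vertex. A crossing is a point interior to two distinct edges; no third edge passes through it, and the two edges cross transversally there. An embedded graph is a graph with such a drawing; it is $k$-plane if every edge contains at most $k$ crossing points and no two edge-curves share more than one point. The planarization $G^\times$ is obtained by inserting a dummy-vertex at every crossing point; $\Lambda(G)$ is obtained from $G^\times$ by inserting inside each face of $G^\times$ a face-vertex adjacent to all vertices of $G^\times$ on that face's boundary; the radial graph $R(G)$ is the subgraph of $\Lambda(G)$ formed by all edges incident to face-vertices; the face-distance $d_F(u,v)$ is the number of face-vertices on a shortest $u$–$v$ path in $R(G)$. A vertex cut is a set $S\subseteq V(G)$ whose removal disconnects $G$; a minimum vertex cut is one of minimum size. *)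

(* Defs.v *)
From HB Require Import structures.
From mathcomp Require Import all_boot all_order all_algebra.
From mathcomp Require Import all_classical all_reals all_analysis.
From mathcomp Require Import Rstruct Rstruct_topology.

Set Implicit Arguments.
Unset Strict Implicit.
Unset Printing Implicit Defensive.
Import Order.TTheory GRing.Theory Num.Theory.

Local Open Scope classical_set_scope.
Local Open Scope ring_scope.

Definition RR : realType := Rdefinitions.R.
Definition plane := (RR * RR)%type.

Definition I01 : set RR := [set t | 0 <= t <= 1].
Definition I01o : set RR := [set t | 0 < t < 1].

Section Drawings.
(** A finite graph with vertex type V, edge type E, each edge e joining
    src e and dst e; a drawing places vertex v at pos v and edge e along the
    curve (curve e) restricted to [0,1]. *)
Variables (V E : finType) (src dst : E -> V).
Variables (pos : V -> plane) (curve : E -> RR -> plane).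

Definition simple_graph : Prop :=
  (forall e, src e != dst e) /\
  (forall e1 e2, ((src e1 == src e2) && (dst e1 == dst e2)) ||
                 ((src e1 == dst e2) && (dst e1 == src e2)) -> e1 = e2).

Definition adj : rel V :=
  fun u v => [exists e, ((src e == u) && (dst e == v)) || ((src e == v) && (dst e == u))].

Definition edge_img (e : E) : set plane := curve e @` I01.
Definition edge_int (e : E) : set plane := curve e @` I01o.

Definition crossing (q : plane) : Prop :=
  exists e1 e2, e1 <> e2 /\ edge_int e1 q /\ edge_int e2 q.

(** transversal crossing of edge e1 (at parameter t1) and e2 (at parameter t2):
    near the crossing, a homeomorphism of the plane maps the two curves onto
    the two coordinate axes (so they genuinely cross rather than touch). *)
Definition transversal (e1 e2 : E) (t1 t2 : RR) : Prop :=
  exists (a b c d : RR) (phi psi : plane -> plane),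
    [/\ 0 <= a < t1, t1 < b <= 1, 0 <= c < t2 & t2 < d <= 1] /\
    [/\ continuous phi, continuous psi, cancel phi psi & cancel psi phi] /\
    (forall s, a <= s <= b -> phi (curve e1 s) = (s - t1, 0)) /\
    (forall s, c <= s <= d -> phi (curve e2 s) = (0, s - t2)).

Definition is_drawing : Prop :=
  injective pos /\
  (forall e, [/\ {within I01, continuous (curve e)},
                {in I01 &, injective (curve e)},
                curve e 0 = pos (src e) & curve e 1 = pos (dst e)]) /\
  (forall e v, ~ edge_int e (pos v)) /\
  (forall e1 e2 t1 t2, e1 <> e2 -> I01o t1 -> I01o t2 ->
     curve e1 t1 = curve e2 t2 ->
     (forall e3, e3 <> e1 -> e3 <> e2 -> ~ edge_int e3 (curve e1 t1)) /\
     transversal e1 e2 t1 t2).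

Definition k_plane (k : nat) : Prop :=
  is_drawing /\
  (forall e, exists s : seq plane, (size s <= k)%N /\
       forall q, edge_int e q -> crossing q -> List.In q s) /\
  (forall e1 e2, e1 <> e2 -> forall q1 q2,
       edge_img e1 q1 -> edge_img e2 q1 -> edge_img e1 q2 -> edge_img e2 q2 ->
       q1 = q2).

Definition drawn : set plane :=
  [set q | exists v, q = pos v] `|` [set q | exists e, edge_img e q].

(** faces of the planarization G^x = connected components of the complement *)
Definition face (F : set plane) : Prop :=
  exists x, ~ drawn x /\ F = connected_component (~` drawn) x.

Definition gx_vertex (q : plane) : Prop := (exists v, q = pos v) \/ crossing q.

(** vertex q of G^x lies on the boundary of face F (adjacent to F's face-vertex) *)
Definition on_face (q : plane) (F : set plane) : Prop :=
  gx_vertex q /\ closure F q.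

(** fwalk m a b : a walk in the radial graph R(G) from a to b
    passing through exactly m face-vertices *)
Inductive fwalk : nat -> plane -> plane -> Prop :=
| fwalk0 a : fwalk 0 a a
| fwalkS m a b c F : face F -> on_face a F -> on_face b F ->
    fwalk m b c -> fwalk m.+1 a c.

Definition face_dist_ge (r : nat) (u v : V) : Prop :=
  forall m, fwalk m (pos u) (pos v) -> (r <= m)%N.

Definition del_rel (S : {set V}) : rel V :=
  fun x y => [&& adj x y, x \notin S & y \notin S].

Definition vertex_cut (S : {set V}) : Prop :=
  exists x y, [/\ x \notin S, y \notin S & ~~ connect (del_rel S) x y].

Definition min_vertex_cut (S : {set V}) : Prop :=
  vertex_cut S /\ forall T, vertex_cut T -> (#|S| <= #|T|)%N.

Definition unique_min_vertex_cut (S : {set V}) : Prop :=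
  min_vertex_cut S /\ forall T, min_vertex_cut T -> T = S.

End Drawings.

(* Main.v *)
(**
If p = 1, a path with three vertices works. Otherwise put q = floor (sqrt k), so that q >= 2,
q^2 <= k and p < 2q.

Nest N = 2rp triangular rings. Each ring is a cyclic sequence of clusters of q vertices in
which consecutive clusters are completely joined, so no ring is disconnected by deleting fewer
than 2q vertices. Rings j and j+2 are linked by 2q disjoint "long" edges, each of which crosses
ring j+1 in a single gap between consecutive clusters. Thus the even rings and the odd rings
form two graphs that stay connected when at most p vertices are deleted; they are connected to
each other only through p further vertices s_t, where s_t lies between the rings 2rt and 2rt+1
and is adjacent to 2q vertices of each. Hence {s_t} is the only vertex cut of size at most p.

An edge within a ring is crossed by at most (q-1)^2 edges of the same gap and, depending on the
gap, by one long edge or by 2(q-1) edges at some s_t; the other edges only cross edges of a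
single gap. All these numbers are at most q^2.

Each ring contains a full triangle, which is a level set of the gauge max (x, y, -x-y), so one
step in the radial graph cannot jump over a ring. Two vertices s_t are separated by at least
2r rings, hence they are at face-distance at least r.

Edges are straight segments. To avoid triple points, all vertices off these triangles are moved
generically by at most eps, one at a time, avoiding finitely many lines; every other property
of the drawing holds for each perturbation of size eps of the nominal positions.
*)
Require Import Defs.
From HB Require Import structures.
From mathcomp Require Import all_boot all_order all_algebra.
From mathcomp Require Import all_classical all_reals all_analysis.
From mathcomp Require Import Rstruct Rstruct_topology.
From mathcomp Require Import ring lra zify.

Set Implicit Arguments.
Unset Strict Implicit.
Unset Printing Implicit Defensive.
Import Order.TTheory GRing.Theory Num.Theory.
Import numFieldNormedType.Exports.

Local Open Scope classical_set_scope.
Local Open Scope ring_scope.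

(** * Straight-line drawings *)

Definition lin (a b : plane) (t : RR) : plane :=
  ((1 - t) * a.1 + t * b.1, (1 - t) * a.2 + t * b.2).

Definition seg (a b z : plane) : Prop := exists2 t, 0 <= t <= 1 & z = lin a b t.

Lemma lin0 a b : lin a b 0 = a.
Proof. by case: a => x y; rewrite /lin /=; congr pair; ring. Qed.

Lemma lin1 a b : lin a b 1 = b.
Proof. by case: b => x y; rewrite /lin /=; congr pair; ring. Qed.

Lemma linC a b t : lin a b t = lin b a (1 - t).
Proof. by rewrite /lin; congr pair; ring. Qed.

Lemma lin_inj a b : a <> b -> injective (lin a b).
Proof.
move=> ab s t [e1 e2]; apply/eqP; rewrite -subr_eq0; apply/negP => /negP st.
apply: ab; case: a b e1 e2 => [a1 a2] [b1 b2] /= e1 e2.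
have h1 : (s - t) * (b1 - a1) = 0.
  by have : (1 - s) * a1 + s * b1 - ((1 - t) * a1 + t * b1) = 0;
     [rewrite e1 subrr|move=> <-; ring].
have h2 : (s - t) * (b2 - a2) = 0.
  by have : (1 - s) * a2 + s * b2 - ((1 - t) * a2 + t * b2) = 0;
     [rewrite e2 subrr|move=> <-; ring].
move/eqP: h1; rewrite mulf_eq0 (negbTE st) subr_eq0 /= => /eqP ->.
by move/eqP: h2; rewrite mulf_eq0 (negbTE st) subr_eq0 /= => /eqP ->.
Qed.

Lemma segl a b : seg a b a.
Proof. by exists 0; rewrite ?lin0 // lexx ler01. Qed.

Lemma segr a b : seg a b b.
Proof. by exists 1; rewrite ?lin1 // ler01 lexx. Qed.

Lemma segC a b z : seg a b z -> seg b a z.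
Proof. by case=> t t01 ->; exists (1 - t); [lra|rewrite linC]. Qed.

Lemma continuous_pair (T : topologicalType) (f g : T -> RR) :
  continuous f -> continuous g -> continuous (fun x => (f x, g x) : plane).
Proof.
move=> cf cg x.
exact: (@cvg_pair _ _ _ _ _ _ (nbhs_filter x) (nbhs_filter _) (nbhs_filter _) _ _ (cf x) (cg x)).
Qed.

Lemma continuous_affine1 (a b : RR) : continuous (fun t : RR => (1 - t) * a + t * b).
Proof.
move=> t; apply: cvgD; apply: cvgM; (try exact: cvg_cst); (try exact: cvg_id).
by apply: cvgB; [exact: cvg_cst|exact: cvg_id].
Qed.

Lemma continuous_lin a b : continuous (lin a b).
Proof. by apply: continuous_pair; exact: continuous_affine1. Qed.

Lemma continuous_affine2 (a b c : RR) :
  continuous (fun z : plane => a * z.1 + b * z.2 + c).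
Proof.
move=> z; apply: cvgD; last exact: cvg_cst.
by apply: cvgD; apply: cvgM; (try exact: cvg_cst); [exact: cvg_fst|exact: cvg_snd].
Qed.

(** The affine map [g] turns the parameter of [C D] into that of [A B]; it is increasing, and
    [[g 0, g 1]] contains [[t1, t2]]. If [g 0] were not 0, the larger of the two left ends would lie
    on the other segment without being an end of it, against the hypotheses. The right ends are
    treated in the same way. *)
Lemma seg_overlap_codirected (A B C D : plane) (t1 t2 s1 s2 : RR) :
  A <> B ->
  (seg A B C -> C = A \/ C = B) -> (seg A B D -> D = A \/ D = B) ->
  (seg C D A -> A = C \/ A = D) -> (seg C D B -> B = C \/ B = D) ->
  0 <= t1 -> t1 < t2 -> t2 <= 1 -> 0 <= s1 -> s1 < s2 -> s2 <= 1 ->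
  lin A B t1 = lin C D s1 -> lin A B t2 = lin C D s2 -> A = C /\ B = D.
Proof.
move=> AB hC hD hA hB t10 t12 t21 s10 s12 s21 e1 e2.
pose k := (t2 - t1) / (s2 - s1); pose g s := t1 + (s - s1) * k.
have s0 : s2 - s1 != 0 by rewrite subr_eq0 gt_eqF.
have k0 : 0 < k by rewrite divr_gt0 // subr_gt0.
have kE : k * (s2 - s1) = t2 - t1 by rewrite /k divfK.
have gE s : lin C D s = lin A B (g s).
  case: A B C D e1 e2 {AB hC hD hA hB} => [a1 a2] [b1 b2] [c1 c2] [d1 d2].
  rewrite /lin /= => -[e11 e12] [e21 e22].
  have E (a b c d : RR) : (1 - t1) * a + t1 * b = (1 - s1) * c + s1 * d ->
      (1 - t2) * a + t2 * b = (1 - s2) * c + s2 * d ->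
      (1 - s) * c + s * d = (1 - g s) * a + g s * b.
    move=> h1 h2.
    have h : (s2 - s1) * (d - c) = (t2 - t1) * (b - a).
      have -> : (s2 - s1) * (d - c) =
        ((1 - s2) * c + s2 * d) - ((1 - s1) * c + s1 * d) by ring.
      by rewrite -h1 -h2; ring.
    have h' : d - c = k * (b - a).
      by apply: (mulfI s0); rewrite h mulrA (mulrC (s2 - s1)) kE.
    have -> : (1 - s) * c + s * d = (1 - s1) * c + s1 * d + (s - s1) * (d - c) by ring.
    by rewrite -h1 h' /g; ring.
  by rewrite (E _ _ _ _ e11 e21) (E _ _ _ _ e12 e22).
have CE : C = lin A B (g 0) by rewrite -gE lin0.
have DE : D = lin A B (g 1) by rewrite -gE lin1.
have g0 : g 0 <= t1 by rewrite /g; nra.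
have g1 : t2 <= g 1 by rewrite /g -lerBlDl -kE mulrC ler_pM2r //; lra.
have gk : g 1 = g 0 + k by rewrite /g; ring.
have inj := lin_inj AB.
have gA s : A = lin C D s -> g s = 0 by rewrite gE -{1}(lin0 A B) => /inj.
have gB s : B = lin C D s -> g s = 1 by rewrite gE -{1}(lin1 A B) => /inj.
have AC : A = C.
  have [h|h|h] := ltgtP (g 0) 0; last by rewrite CE h lin0.
    have /hA : seg C D A.
      exists (- g 0 / k).
        by rewrite divr_ge0 ?(ltW k0) ?oppr_ge0 ?(ltW h) //= ler_pdivrMr //; lra.
      rewrite gE -{1}(lin0 A B); congr lin; rewrite /g mulrBl mulfVK ?gt_eqF //.
      by rewrite /g; ring.
    case=> // AD; exfalso; have := gA 1; rewrite lin1 => /(_ AD); lra.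
  have /hC : seg A B C by exists (g 0); [lra|].
  case=> // CB; exfalso; have := gB 0; rewrite lin0 => /(_ (esym CB)); lra.
split=> //.
have G0 : g 0 = 0 by apply: gA; rewrite lin0.
have [h|h|h] := ltgtP (g 1) 1; last by rewrite DE h lin1.
  have /hD : seg A B D by exists (g 1); [lra|].
  case=> // DA; exfalso; have := gA 1; rewrite lin1 => /(_ (esym DA)); lra.
have /hB : seg C D B.
  exists (k^-1); first by rewrite invr_ge0 ltW //= invf_le1 //; lra.
  rewrite gE -{1}(lin1 A B); congr lin.
  have -> : g k^-1 = g 0 + k^-1 * k by rewrite /g; ring.
  by rewrite mulVf ?gt_eqF // G0 add0r.
case=> // BC; exfalso; have := gB 0; rewrite lin0 => /(_ BC); lra.
Qed.

Lemma seg_overlap (A B C D z1 z2 : plane) :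
  A <> B ->
  (seg A B C -> C = A \/ C = B) -> (seg A B D -> D = A \/ D = B) ->
  (seg C D A -> A = C \/ A = D) -> (seg C D B -> B = C \/ B = D) ->
  seg A B z1 -> seg C D z1 -> seg A B z2 -> seg C D z2 -> z1 <> z2 ->
  (A = C /\ B = D) \/ (A = D /\ B = C).
Proof.
move=> AB hC hD hA hB [t1 t1I e1] [s1 s1I f1] [t2 t2I e2] [s2 s2I f2] z12.
wlog t12 : z1 z2 t1 t2 s1 s2 t1I t2I s1I s2I e1 e2 f1 f2 z12 / t1 < t2.
  move=> H; have [h|h|h] := ltgtP t1 t2.
  - exact: (H z1 z2 t1 t2 s1 s2).
  - by apply: (H z2 z1 t2 t1 s2 s1) => // /esym.
  - by case: z12; rewrite e1 e2 h.
have [h|h|h] := ltgtP s1 s2.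
- left; apply: (@seg_overlap_codirected A B C D t1 t2 s1 s2) => //; rewrite -?e1 -?e2 //; lra.
- right; apply: (@seg_overlap_codirected A B D C t1 t2 (1 - s1) (1 - s2)) => //.
  + by move/segC/hA => [|]; [right|left].
  + by move/segC/hB => [|]; [right|left].
  + lra.
  + lra.
  + lra.
  + lra.
  + lra.
  + by rewrite -linC -e1.
  + by rewrite -linC -e2.
- by case: z12; rewrite f1 f2 h.
Qed.

(** Used to exclude parallel crossing edges: from a common interior point one can move a little
    along both segments at once. *)
Lemma parallel_second_common (A B C D : plane) (t1 t2 : RR) :
  C <> D -> 0 < t1 < 1 -> 0 < t2 < 1 -> lin A B t1 = lin C D t2 ->
  (B.1 - A.1) * (D.2 - C.2) - (B.2 - A.2) * (D.1 - C.1) = 0 ->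
  exists2 s, 0 <= s <= 1 /\ s <> t1 & seg C D (lin A B s).
Proof.
case: A B C D => [a1 a2] [b1 b2] [c1 c2] [d1 d2] CD t1I t2I [/= e1 e2] det.
pose n := (d1 - c1) ^+ 2 + (d2 - c2) ^+ 2.
have n0 : n != 0.
  rewrite /n paddr_eq0 ?sqr_ge0 // !sqrf_eq0; apply/negP => /andP[/eqP h1 /eqP h2].
  by apply: CD; congr pair; lra.
pose mu := ((b1 - a1) * (d1 - c1) + (b2 - a2) * (d2 - c2)) / n.
have nm : n * mu = (b1 - a1) * (d1 - c1) + (b2 - a2) * (d2 - c2).
  by rewrite /mu mulrC divfK.
have m1 : b1 - a1 = mu * (d1 - c1).
  apply: (mulfI n0); rewrite [RHS]mulrA nm /n.
  apply/eqP; rewrite -subr_eq0; apply/eqP.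
  transitivity ((d2 - c2) * ((b1 - a1) * (d2 - c2) - (b2 - a2) * (d1 - c1))); first by ring.
  by rewrite det mulr0.
have m2 : b2 - a2 = mu * (d2 - c2).
  apply: (mulfI n0); rewrite [RHS]mulrA nm /n.
  apply/eqP; rewrite -subr_eq0; apply/eqP.
  transitivity (- (d1 - c1) * ((b1 - a1) * (d2 - c2) - (b2 - a2) * (d1 - c1))); first by ring.
  by rewrite det mulr0.
pose m := Num.min (1 - t1) (Num.min t2 (1 - t2)).
have m0 : 0 < m by rewrite !lt_min; lra.
have [ma mb mc] : [/\ m <= 1 - t1, m <= t2 & m <= 1 - t2].
  by split; rewrite /m !ge_min lexx ?orbT.
(* Moving by [h] on [A B] amounts to moving by [h * mu] on [C D]. Since [h + |h * mu| = m], both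
   parameters stay in [[0, 1]]. *)
pose h := m / (1 + `|mu|).
have p0 : 0 < 1 + `|mu| by rewrite ltr_wpDr.
have h0 : 0 < h by rewrite divr_gt0.
have hE : h * (1 + `|mu|) = m by rewrite /h divfK // gt_eqF.
have hmu : h + `|h * mu| = m by rewrite normrM (gtr0_norm h0) -hE; ring.
have : - `|h * mu| <= h * mu <= `|h * mu| by rewrite -ler_norml.
move: (normr_ge0 (h * mu)) => ? ?.
exists (t1 + h); first by split; [lra|lra].
exists (t2 + h * mu); first by lra.
rewrite /lin /=; congr pair.
- transitivity ((1 - t1) * a1 + t1 * b1 + h * (b1 - a1)); first by ring.
  by rewrite e1 m1; ring.
- transitivity ((1 - t1) * a2 + t1 * b2 + h * (b2 - a2)); first by ring.
  by rewrite e2 m2; ring.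
Qed.

Lemma continuous_affine_plane (a b c a' b' c' : RR) :
  continuous ((fun z : plane => (a * z.1 + b * z.2 + c, a' * z.1 + b' * z.2 + c') : plane)).
Proof. by apply: continuous_pair; exact: continuous_affine2. Qed.

(** * Straight drawings with no vertex on a foreign edge *)

Definition touch (V E : finType) (src dst : E -> V) : rel E := fun e f =>
  [|| src e == src f, src e == dst f, dst e == src f | dst e == dst f].

Section StraightDrawing.
Variables (V E : finType) (src dst : E -> V) (pos : V -> plane).

Definition straight (e : E) : RR -> plane := lin (pos (src e)) (pos (dst e)).
Definition eseg (e : E) : plane -> Prop := seg (pos (src e)) (pos (dst e)).

Definition off_edges : Prop := forall e v, eseg e (pos v) -> v = src e \/ v = dst e.

Hypothesis simpleG : simple_graph src dst.
Hypothesis pos_inj : injective pos.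
Hypothesis pos_off : off_edges.

Lemma edge_imgE e z : edge_img straight e z -> eseg e z.
Proof. by case=> t t01 <-; exists t. Qed.

Lemma edge_int_seg e z : edge_int straight e z -> eseg e z.
Proof. by case=> t /andP[t0 t1] <-; exists t => //; rewrite !ltW. Qed.

Lemma straight_ends_neq e : pos (src e) <> pos (dst e).
Proof. by move/pos_inj/eqP; rewrite (negbTE (simpleG.1 e)). Qed.

(** By [off_edges], the ends of one edge can lie on the other only as ends, so two common points
    would give both edges the same pair of ends. Simplicity excludes this. *)
Lemma edges_meet_once e f z1 z2 : e <> f ->
  eseg e z1 -> eseg f z1 -> eseg e z2 -> eseg f z2 -> z1 = z2.
Proof.
move=> ef h1 h2 h3 h4; apply: contrapT => z12; apply: ef.
have H e1 e2 v : v = src e2 \/ v = dst e2 -> eseg e1 (pos v) ->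
    pos v = pos (src e1) \/ pos v = pos (dst e1).
  by move=> _ /pos_off [] ->; [left|right].
have [] := seg_overlap (straight_ends_neq (e := e))
   (H e f _ (or_introl erefl)) (H e f _ (or_intror erefl))
   (H f e _ (or_introl erefl)) (H f e _ (or_intror erefl)) h1 h2 h3 h4 z12.
  by case=> /pos_inj a /pos_inj b; apply: simpleG.2; rewrite a b !eqxx.
by case=> /pos_inj a /pos_inj b; apply: simpleG.2; rewrite a b !eqxx orbT.
Qed.

(** A common end would be the only common point of the two edges, but an interior point of [e] is
    not an end of [e]. *)
Lemma crossing_ntouch e f z : e <> f ->
  edge_int straight e z -> edge_int straight f z -> ~~ touch src dst e f.
Proof.
move=> ef ez fz; apply/negP => tef.
have [w [we wf]] : exists w, (w = src e \/ w = dst e) /\ (w = src f \/ w = dst f).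
  case/or4P: tef => /eqP h; [exists (src e)|exists (src e)|exists (dst e)|exists (dst e)];
    by split; auto.
have H g : w = src g \/ w = dst g -> eseg g (pos w).
  by case=> ->; [exact: segl|exact: segr].
have zw := edges_meet_once ef (edge_int_seg ez) (edge_int_seg fz) (H _ we) (H _ wf).
case: ez => t /andP[t0 t1] tz; have inj := lin_inj (straight_ends_neq (e := e)).
case: we => we; move: tz; rewrite zw we /straight.
  by rewrite -[X in _ = X](lin0 _ (pos (dst e))) => /inj; lra.
by rewrite -[X in _ = X](lin1 (pos (src e))) => /inj; lra.
Qed.

Lemma straight_transversal e1 e2 t1 t2 : e1 <> e2 -> I01o t1 -> I01o t2 ->
  straight e1 t1 = straight e2 t2 -> Defs.transversal straight e1 e2 t1 t2.
Proof.
move=> e12 t1I t2I z12.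
set A := pos (src e1); set B := pos (dst e1); set C := pos (src e2); set D := pos (dst e2).
pose det := (B.1 - A.1) * (D.2 - C.2) - (B.2 - A.2) * (D.1 - C.1).
have det0 : det != 0.
  apply/eqP => d0.
  have [s [sI st] sC] := parallel_second_common (straight_ends_neq (e := e2)) t1I t2I z12 d0.
  apply: st; apply: (lin_inj (straight_ends_neq (e := e1))).
  apply: (edges_meet_once e12) => //; first by exists s.
    by exists t1 => //; case/andP: t1I => *; rewrite !ltW.
  by rewrite -/(straight e1 t1) z12; exists t2 => //; case/andP: t2I => *; rewrite !ltW.
pose z := straight e1 t1.
(* [psi] sends the origin to the crossing and the two unit vectors to [B - A] and [D - C]; [phi] is
   its inverse by Cramer's rule. *)
pose phi (q : plane) : plane :=
  ((D.2 - C.2) / det * q.1 + (- (D.1 - C.1) / det) * q.2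
     + (z.2 * (D.1 - C.1) - z.1 * (D.2 - C.2)) / det,
   (- (B.2 - A.2) / det) * q.1 + (B.1 - A.1) / det * q.2
     + (z.1 * (B.2 - A.2) - z.2 * (B.1 - A.1)) / det).
pose psi (q : plane) : plane :=
  ((B.1 - A.1) * q.1 + (D.1 - C.1) * q.2 + z.1,
   (B.2 - A.2) * q.1 + (D.2 - C.2) * q.2 + z.2).
exists 0, 1, 0, 1, phi, psi.
split; first by split; move: t1I t2I; rewrite /I01o /=; lra.
split.
  split; [exact: continuous_affine_plane|exact: continuous_affine_plane| |].
    move=> [x y]; rewrite /phi /psi /=; congr pair; rewrite -[RHS]mul1r -(mulfV det0) /det;
      by field; exact: det0.
  move=> [x y]; rewrite /phi /psi /=; congr pair; rewrite /det; by field; exact: det0.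
split=> s _.
  rewrite /phi /z /straight /lin -/A -/B /=; congr pair; rewrite /det; field; exact: det0.
rewrite /phi /z z12 /straight /lin -/C -/D /=; congr pair; rewrite /det; field; exact: det0.
Qed.

Definition cross (e f : E) : Prop :=
  exists2 z, edge_int straight e z & edge_int straight f z.

(** The crossings on [e] are counted through the edges that cross it: [code e] is injective on these
    edges, and each of them meets [e] only once. *)
Lemma straight_k_plane (k : nat) (I : finType) (code : E -> E -> I) :
  (forall e1 e2 e3 z, e1 <> e2 -> e3 <> e1 -> e3 <> e2 ->
     edge_int straight e1 z -> edge_int straight e2 z -> ~ edge_int straight e3 z) ->
  (#|I| <= k)%N ->
  (forall e f g, f <> e -> g <> e -> cross e f -> cross e g ->
     code e f = code e g -> f = g) ->
  k_plane src dst pos straight k.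
Proof.
move=> notriple Ik codeI; split; last first.
  split; last first.
    move=> e1 e2 e12 q1 q2 /edge_imgE h1 /edge_imgE h2 /edge_imgE h3 /edge_imgE h4.
    exact: edges_meet_once h1 h2 h3 h4.
  move=> e.
  pose P (c : I) (z : plane) := exists f,
    [/\ f <> e, code e f = c, edge_int straight e z & edge_int straight f z].
  (* For a code that no crossing edge has, [pt] returns an end of [e]; this only adds a spurious
     point to the list. *)
  pose pt c := xget (pos (src e)) (P c).
  exists [seq pt c | c <- enum I]; split; first by rewrite size_map -cardE.
  move=> q eq [e1 [e2 [e12 [q1 q2]]]].
  have [f fe fq] : exists2 f, f <> e & edge_int straight f q.
    have [h|h] := pselect (e1 = e); last by exists e1.
    by exists e2 => //; rewrite -h => /esym.
  have Pq : P (code e f) q by exists f.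
  have -> : q = pt (code e f).
    rewrite /pt; case: xgetP => [y _ [g [ge cg ey gy]]|/(_ _ Pq)//].
    have fg : f = g by apply: (codeI e) => //; [exists q|exists y].
    apply: (edges_meet_once (e := e) (f := f)); [by move/esym| | | |];
      apply: edge_int_seg => //; by rewrite fg.
  have : code e f \in enum I by rewrite mem_enum.
  by elim: (enum I) => //= a l IH; rewrite in_cons => /orP[/eqP ->|/IH]; [left|right].
split; first exact: pos_inj.
split.
  move=> e; split; [|  |exact: lin0|exact: lin1].
    by apply: continuous_subspaceT; exact: continuous_lin.
  by move=> s t _ _; apply: lin_inj; exact: straight_ends_neq.
split.
  move=> e v [t /andP[t0 t1] tv].
  have /pos_off : eseg e (pos v) by exists t => //; rewrite !ltW.
  have inj := lin_inj (straight_ends_neq (e := e)).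
  case=> ve; move: tv; rewrite ve /straight.
    by rewrite -[X in _ = X](lin0 _ (pos (dst e))) => /inj; lra.
  by rewrite -[X in _ = X](lin1 (pos (src e))) => /inj; lra.
move=> e1 e2 t1 t2 e12 t1I t2I z12; split; last exact: straight_transversal.
move=> e3 e31 e32; apply: (notriple e1 e2) => //; first by exists t1.
by rewrite z12; exists t2.
Qed.

End StraightDrawing.

(** * Generic positions *)

(** The point is sought on the parabola arc [c + eps * (t, t^2)] with [t] in [[0, 1]]. Each line
    meets the parabola at the roots of a nonzero polynomial [P i], so only finitely many [t] are
    bad. *)
Lemma avoid_lines (I : finType) (al be ga : I -> RR) (c : plane) (eps : RR) :
  0 < eps -> (forall i, al i != 0 \/ be i != 0) ->
  exists z : plane, [/\ `|z.1 - c.1| <= eps, `|z.2 - c.2| <= eps &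
    forall i, al i * z.1 + be i * z.2 != ga i].
Proof.
move=> e0 nz.
pose P i : {poly RR} := (al i * c.1 + be i * c.2 - ga i)%:P
   + (al i * eps) *: 'X + (be i * eps) *: 'X^2.
have PE i t : (P i).[t] = al i * (c.1 + eps * t) + be i * (c.2 + eps * t ^+ 2) - ga i.
  by rewrite /P !hornerD hornerC !hornerZ hornerX hornerXn; ring.
have Pn0 i : P i != 0.
  apply/eqP => P0.
  have C k : (P i)`_k = 0 by rewrite P0 coef0.
  have := C 1%N; have := C 2%N; rewrite /P !coefE /= !(mulr1, mulr0, addr0, add0r).
  move=> /eqP; rewrite mulf_eq0 (gt_eqF e0) orbF => /eqP b0.
  move=> /eqP; rewrite mulf_eq0 (gt_eqF e0) orbF => /eqP a0.
  by case: (nz i); rewrite ?a0 ?b0 eqxx.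
pose Q := \prod_i P i.
have Qn0 : Q != 0 by apply/prodf_neq0 => i _.
(* These are [size Q] distinct values in []0, 1]], one more than the degree of [Q], so they are not
   all roots. *)
pose rs : seq RR := [seq n.+1%:R^-1 | n <- iota 0 (size Q)].
have urs : uniq rs.
  by rewrite map_inj_uniq ?iota_uniq // => m n /invr_inj /eqP; rewrite eqr_nat => /eqP [].
have : ~~ all (root Q) rs.
  by apply/negP => /(max_poly_roots Qn0) /(_ urs); rewrite size_map size_iota ltnn.
case/allPn => _ /mapP [n _ ->]; set t : RR := _^-1 => nr.
have t0 : 0 <= t by rewrite invr_ge0 ler0n.
have t1 : t <= 1 by rewrite invf_le1 ?ltr0Sn // ler1n.
exists (c.1 + eps * t, c.2 + eps * t ^+ 2); split => /=.
- by rewrite addrAC subrr add0r ger0_norm ?mulr_ge0 ?(ltW e0) // ler_piMr // ltW.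
- by rewrite addrAC subrr add0r ger0_norm ?mulr_ge0 ?exprn_ge0 ?(ltW e0) //
     ler_piMr ?(ltW e0) // exprn_ile1.
- move=> i; rewrite -subr_eq0 -PE; apply: contraNneq nr => Pt.
  rewrite /root /Q horner_prod; apply/eqP; apply/eqP/prodf_eq0; exists i => //.
  by rewrite Pt.
Qed.

Section GenericPosition.
Variables (V E : finType) (src dst : E -> V) (c : V -> plane) (eps : RR) (fixed : pred V).

Definition admissible (pos : V -> plane) : Prop := forall v,
  [/\ `|(pos v).1 - (c v).1| <= eps, `|(pos v).2 - (c v).2| <= eps & fixed v -> pos v = c v].

Hypothesis eps0 : 0 < eps.
Hypothesis simpleG : simple_graph src dst.
Hypothesis inj_adm : forall pos, admissible pos -> injective pos.
Hypothesis off_adm : forall pos, admissible pos -> off_edges src dst pos.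

Definition ends_in (P : pred V) (e : E) := P (src e) && P (dst e).

Definition concurrent (pos : V -> plane) (e1 e2 e3 : E) : Prop :=
  exists z, [/\ eseg src dst pos e1 z, eseg src dst pos e2 z & eseg src dst pos e3 z].

Let other v e := if src e == v then dst e else src e.
Let on v e := (src e == v) || (dst e == v).

(** When only [v] moves, [e2] and [e3] stay fixed and have at most one common point [z]. If [e1],
    whose other end is [u], passes through [z], then [v] lies on the line through [u] and [z]. This
    is a genuine line, because [u] is not on [e2]. *)
Lemma forbidden_line pos v e1 e2 e3 : admissible pos ->
  on v e1 -> ~~ on v e2 -> ~~ on v e3 ->
  ~~ touch src dst e1 e2 -> ~~ touch src dst e1 e3 -> ~~ touch src dst e2 e3 ->
  exists al be ga : RR, (al != 0 \/ be != 0) /\ forall pos',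
    (forall w, w != v -> pos' w = pos w) ->
    al * (pos' v).1 + be * (pos' v).2 != ga -> ~ concurrent pos' e1 e2 e3.
Proof.
move=> adm v1 v2 v3 t12 t13 t23.
set u := other v e1.
have uv : u != v.
  rewrite /u /other; case: (src e1 =P v) => [<-|/eqP//].
  by rewrite eq_sym; exact: simpleG.1.
have eE pos' z : (eseg src dst pos' e1 z) -> seg (pos' u) (pos' v) z.
  rewrite /eseg /u /other; case: eqP => [sv|sv]; first by rewrite -sv => /segC.
  by case/orP: v1 => /eqP => [/sv|<-].
have nE pos' e z : ~~ on v e -> (forall w, w != v -> pos' w = pos w) ->
    eseg src dst pos' e z = eseg src dst pos e z.
  by rewrite negb_or => /andP[h1 h2] H; rewrite /eseg !H.
have u2 : u <> src e2 /\ u <> dst e2.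
  move: t12; rewrite /touch !negb_or => /and4P[/eqP ? /eqP ? /eqP ? /eqP ?].
  by rewrite /u /other; case: eqP.
have [[z [z2 z3]]|nz] := pselect (exists z, eseg src dst pos e2 z /\ eseg src dst pos e3 z);
  last first.
  (* Here [e2] and [e3] are disjoint, so any line will do. *)
  exists 1, 0, 0; split; first by left; exact: oner_neq0.
  move=> pos' H _ [z [_ z2 z3]]; apply: nz; exists z.
  by rewrite -(nE pos') // -(nE pos' e3).
have e23 : e2 <> e3.
  by move=> h; move: t23; rewrite h /touch eqxx.
have uz : pos u <> z.
  by move=> h; have [] := off_adm adm (e := e2) (v := u); rewrite ?h //; case: u2.
exists (z.2 - (pos u).2), (- (z.1 - (pos u).1)),
  ((z.2 - (pos u).2) * (pos u).1 - (z.1 - (pos u).1) * (pos u).2); split.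
  have [h|h] := eqVneq (z.2 - (pos u).2) 0; last by left.
  right; rewrite oppr_eq0; apply/eqP => h'; apply: uz.
  by case: z (pos u) h h' {z2 z3} => [? ?] [? ?] /= *; congr pair; lra.
move=> pos' H /eqP nl [z' [z1 z2' z3']]; apply: nl.
rewrite (nE pos') // in z2'; rewrite (nE pos') // in z3'.
have zz : z' = z by apply: (edges_meet_once simpleG (inj_adm adm) (off_adm adm) e23).
case: (eE _ _ z1) => t _; rewrite zz H // => zE.
have zE1 : z.1 - (pos u).1 = t * ((pos' v).1 - (pos u).1) by rewrite zE /lin /=; ring.
have zE2 : z.2 - (pos u).2 = t * ((pos' v).2 - (pos u).2) by rewrite zE /lin /=; ring.
by rewrite zE1 zE2; ring.
Qed.

(** Induction on the vertices already placed: the new vertex avoids one line for each triple of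
    edges, and the triples settled before do not contain it. Triples whose edges all have fixed ends
    are beyond the reach of perturbation and are left to the caller. *)
Lemma generic_on (W : seq V) : exists2 pos, admissible pos &
  forall e1 e2 e3, ~~ touch src dst e1 e2 -> ~~ touch src dst e1 e3 ->
    ~~ touch src dst e2 e3 ->
    let P := [pred v | fixed v || (v \in W)] in
    ends_in P e1 -> ends_in P e2 -> ends_in P e3 ->
    ~~ [&& ends_in fixed e1, ends_in fixed e2 & ends_in fixed e3] ->
    ~ concurrent pos e1 e2 e3.
Proof.
elim: W => [|v W [pos adm IH]].
  exists c; first by move=> v; rewrite !subrr normr0 ltW.
  move=> e1 e2 e3 _ _ _ P h1 h2 h3.
  have PE e : ends_in P e = ends_in fixed e by rewrite /ends_in /= !orbF.
  by rewrite -!PE h1 h2 h3.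
have [vP|] := boolP (fixed v || (v \in W)).
  exists pos => // e1 e2 e3 t12 t13 t23 P h1 h2 h3; apply: IH => //.
  - move: h1; rewrite /ends_in /= !inE.
    have D w : fixed w || (w == v) || (w \in W) = fixed w || (w \in W).
      by have [->|] := eqVneq w v; rewrite ?orbT ?orbF // vP.
    by rewrite !orbA !D.
  - move: h2; rewrite /ends_in /= !inE.
    have D w : fixed w || (w == v) || (w \in W) = fixed w || (w \in W).
      by have [->|] := eqVneq w v; rewrite ?orbT ?orbF // vP.
    by rewrite !orbA !D.
  - move: h3; rewrite /ends_in /= !inE.
    have D w : fixed w || (w == v) || (w \in W) = fixed w || (w \in W).
      by have [->|] := eqVneq w v; rewrite ?orbT ?orbF // vP.
    by rewrite !orbA !D.
rewrite negb_or => /andP[nfix vW].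
pose ok (e : E * E * E) := [&& on v e.1.1, ~~ on v e.1.2, ~~ on v e.2,
  ~~ touch src dst e.1.1 e.1.2, ~~ touch src dst e.1.1 e.2 & ~~ touch src dst e.1.2 e.2].
have L (e : E * E * E) : exists l : RR * RR * RR, (l.1.1 != 0 \/ l.1.2 != 0) /\
  (ok e -> forall pos', (forall w, w != v -> pos' w = pos w) ->
    l.1.1 * (pos' v).1 + l.1.2 * (pos' v).2 != l.2 -> ~ concurrent pos' e.1.1 e.1.2 e.2).
  have [/and5P[h1 h2 h3 h4 /andP[h5 h6]]|_] := boolP (ok e); last first.
    by exists (1, 0, 0); split=> //; left; exact: oner_neq0.
  have [a [b [g [ab H]]]] := forbidden_line adm h1 h2 h3 h4 h5 h6.
  by exists (a, b, g).
have [l lP] := choice L.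
have [z [z1 z2 zl]] := @avoid_lines _ (fun e => (l e).1.1) (fun e => (l e).1.2)
  (fun e => (l e).2) (c v) eps eps0 (fun e => (lP e).1).
pose pos' w := if w == v then z else pos w.
have posE w : w != v -> pos' w = pos w by rewrite /pos' => /negbTE ->.
exists pos'.
  move=> w; rewrite /pos'; case: eqP => [->|_]; last exact: adm.
  by split=> //; rewrite (negbTE nfix).
have main e1 e2 e3 : ok (e1, e2, e3) -> ~ concurrent pos' e1 e2 e3.
  move=> oke; apply: (lP (e1, e2, e3)).2 => //.
  by have := zl (e1, e2, e3); rewrite /pos' eqxx.
have tC e f : touch src dst e f = touch src dst f e.
  rewrite /touch; apply/or4P/or4P => -[] /eqP ->; rewrite ?eqxx;
   [constructor 1|constructor 3|constructor 2|constructor 4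
   |constructor 1|constructor 3|constructor 2|constructor 4] => //.
have tN e f : ~~ touch src dst e f -> on v e -> ~~ on v f.
  move=> nt oe; apply: contraNN nt; move: oe; rewrite /on /touch.
  by move=> /orP[] /eqP <- /orP[] /eqP ->; rewrite eqxx ?orbT.
move=> e1 e2 e3 t12 t13 t23 P h1 h2 h3 nf.
(* The three edges are pairwise disjoint, so [v] is on at most one of them. That edge is put first;
   if there is none, the induction hypothesis applies. *)
have [v1|n1] := boolP (on v e1).
  by apply: main; rewrite /ok /= v1 t12 t13 t23 (tN _ _ t12 v1) (tN _ _ t13 v1).
have [v2|n2] := boolP (on v e2).
  have t21 : ~~ touch src dst e2 e1 by rewrite tC.
  move=> [y [y1 y2 y3]]; apply: (main e2 e1 e3); last by exists y.
  by rewrite /ok /= v2 t21 t13 t23 (tN _ _ t21 v2) (tN _ _ t23 v2).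
have [v3|n3] := boolP (on v e3).
  have t31 : ~~ touch src dst e3 e1 by rewrite tC.
  have t32 : ~~ touch src dst e3 e2 by rewrite tC.
  move=> [y [y1 y2 y3]]; apply: (main e3 e1 e2); last by exists y.
  by rewrite /ok /= v3 t31 t32 t12 (tN _ _ t31 v3) (tN _ _ t32 v3).
have eE e z' : ~~ on v e -> eseg src dst pos' e z' = eseg src dst pos e z'.
  by rewrite negb_or => /andP[a b]; rewrite /eseg !posE.
have PE e : ~~ on v e -> ends_in P e -> ends_in [pred v | fixed v || (v \in W)] e.
  rewrite negb_or => /andP[a b]; rewrite /ends_in /= !inE.
  by rewrite (negbTE a) (negbTE b).
move=> [y [y1 y2 y3]]; apply: (IH e1 e2 e3) => //; try exact: PE.
by exists y; rewrite -!eE.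
Qed.

Lemma generic_position : exists2 pos, admissible pos &
  forall e1 e2 e3, ~~ touch src dst e1 e2 -> ~~ touch src dst e1 e3 ->
    ~~ touch src dst e2 e3 ->
    ~~ [&& ends_in fixed e1, ends_in fixed e2 & ends_in fixed e3] ->
    ~ concurrent pos e1 e2 e3.
Proof.
have [pos adm H] := generic_on (enum V); exists pos => // e1 e2 e3 *.
by apply: H => //; rewrite /ends_in /= !mem_enum !orbT.
Qed.

End GenericPosition.

(** * Face-walks and level sets *)

Section Levels.
Variables (V E : finType) (pos : V -> plane) (curve : E -> RR -> plane).
Variable f : plane -> RR.
Hypothesis f_cont : continuous f.

Lemma level_open_lt c : open [set z | f z < c].
Proof. by apply: (@open_comp _ _ f [set x | x < c]) => [z _|]; [exact: f_cont|exact: open_lt]. Qed.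

Lemma level_open_gt c : open [set z | c < f z].
Proof. by apply: (@open_comp _ _ f [set x | c < x]) => [z _|]; [exact: f_cont|exact: open_gt]. Qed.

Lemma level_closed_le c : closed [set z | f z <= c].
Proof.
by apply: (@closed_comp _ _ f [set x | x <= c]) => [z _|]; [exact: f_cont|exact: closed_le].
Qed.

(** A face is connected and misses the level set, so it lies strictly on one side of it; its closure
    then cannot have points strictly on both sides. *)
Lemma face_level c F a b : (forall z, f z = c -> drawn pos curve z) ->
  face pos curve F -> closure F a -> closure F b ->
  ~ (f a < c /\ c < f b).
Proof.
move=> Dc [x [_ FE]] Fa Fb [ac cb].
have Fc z : F z -> f z <> c.
  by rewrite FE => /connected_component_sub zD /Dc.
have [y [Fy yc]] := Fa _ (open_nbhs_nbhs (conj (level_open_lt (c := c)) ac)).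
have [y' [Fy' yc']] := Fb _ (open_nbhs_nbhs (conj (level_open_gt (c := c)) cb)).
have FC : connected F by rewrite FE; exact: component_connected.
(* The part of [F] below the level is open in [F], and also closed in [F], being equal to the part
   where [f <= c]. *)
have BF : F `&` [set z | f z < c] = F.
  apply: FC; first by exists y.
    by exists [set z | f z < c] => //; exact: level_open_lt.
  exists [set z | f z <= c]; first exact: level_closed_le.
  apply/seteqP; split=> z [Fz zc]; split=> //; first exact: ltW.
  by move: zc; rewrite /= le_eqVlt => /orP[/eqP/(Fc _ Fz)|].
by move: Fy'; rewrite -BF => -[_ /= h]; have := lt_trans yc' h; rewrite ltxx.
Qed.

Variables (c : nat -> RR) (n : nat).
Hypothesis c_incr : forall j, c j < c j.+1.
Hypothesis c_drawn : forall j, (j < n)%N -> forall z, f z = c j -> drawn pos curve z.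

(** One face can lead from below level [c j] at most onto that level, hence strictly below [c j.+1]:
    each face-vertex costs one level. *)
Lemma fwalk_outward m a b : fwalk pos curve m a b ->
  forall j, (j + m <= n)%N -> f a < c j -> f b < c (j + m)%N.
Proof.
elim=> [{}a j _|{}m {}a a' {}b F FF [_ Fa] [_ Fa'] _ IH j jm ac]; first by rewrite addn0.
rewrite addnS -addSn; apply: IH; first by rewrite addSn -addnS.
apply: le_lt_trans (c_incr j); rewrite leNgt; apply/negP => a'c.
apply: (@face_level (c j) F a a') => //; apply: c_drawn.
by apply: leq_trans jm; rewrite addnS ltnS leq_addr.
Qed.

Lemma fwalk_inward m a b : fwalk pos curve m a b ->
  forall j, (m <= j)%N -> (j < n)%N -> c j < f a -> c (j - m)%N < f b.
Proof.
elim=> [{}a j _ _|{}m {}a a' {}b F FF [_ Fa] [_ Fa'] _ IH [//|j] jm jn ac].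
  by rewrite subn0.
rewrite subSS; apply: IH => //; first exact: ltnW.
apply: lt_le_trans (c_incr j) _; rewrite leNgt; apply/negP => a'c.
by apply: (@face_level (c j.+1) F a' a) => //; exact: c_drawn.
Qed.

End Levels.

(** * The ring graph and its vertex cuts *)

(** Pigeonhole principle. It is applied below to [2 * q] labels and a deleted set of fewer than
    [2 * q] vertices. *)
Lemma unused_label (T I : finType) (A : {set T}) (lbl : T -> I) :
  (#|A| < #|I|)%N -> exists i, forall v, lbl v = i -> v \notin A.
Proof.
move=> AI; have /subsetPn [i _ iA] : ~~ ([set: I]%SET \subset lbl @: A).
  apply/negP => /subset_leq_card; rewrite cardsT leqNgt.
  by rewrite (leq_ltn_trans (leq_imset_card lbl A) AI).
exists i => v vi; apply: contraNN iA => vA; apply/imsetP; by exists v.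
Qed.

Lemma val_iter_ordS n (i : 'I_n) t : val (iter t (@ordS n) i) = ((i + t) %% n)%N.
Proof.
elim: t => [|t IH] /=; first by rewrite addn0 modn_small.
by rewrite IH -addn1 modnDml addn1 addnS.
Qed.

Lemma val_ordS n (i : 'I_n) : val (ordS i) = if i.+1 == n then 0%N else i.+1.
Proof.
rewrite /=; case: eqP => [->|/eqP ne]; first by rewrite modnn.
by rewrite modn_small // ltn_neqAle ne ltn_ord.
Qed.

Section RingGraph.
Variables (q0 r p : nat).
Hypotheses (r0 : (0 < r)%N) (p0 : (0 < p)%N).
Local Notation q := q0.+2.
Local Notation m := (2 * q0.+2).+3.
Local Notation N := (2 * r * p)%N.
Local Notation V := ('I_N * 'I_m * 'I_q + 'I_p)%type.
Local Notation rv j i a := (inl (j, i, a) : V).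
Local Notation sv t := (inr t : V).

(* The vertex (j, i, a) is the a-th vertex, counted from the inside, of the i-th cluster of
   ring j. The clusters i < 2q lie on one side of the triangle and carry the long edges; the
   clusters 2q, 2q+1, 2q+2 are the corners. *)
Definition arc (u v : V) : bool :=
  match u, v with
  | inl (j, i, a), inl (j', i', b) =>
      ((j' == j) && (i' == ordS i)) ||
      [&& j' == j.+2 :> nat, i' == i, (i < 2 * q)%N, a == ord_max & b == ord0]
  | inr t, inl (j, i, a) =>
      ((j == 2 * r * t :> nat) || (j == (2 * r * t).+1 :> nat))%N &&
      ((i == 2 * q :> nat) || (i == (2 * q).+1 :> nat))%N
  | _, _ => false
  end.

Definition redge := {e : V * V | arc e.1 e.2}.
Definition rsrc (e : redge) : V := (val e).1.
Definition rdst (e : redge) : V := (val e).2.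

Lemma arc_edge (u v : V) : arc u v -> exists2 e : redge, rsrc e = u & rdst e = v.
Proof. by move=> uv; exists (exist _ (u, v) uv). Qed.

Lemma edge_arc (e : redge) : arc (rsrc e) (rdst e).
Proof. exact: (valP e). Qed.

Lemma redge_eq (e f : redge) : rsrc e = rsrc f -> rdst e = rdst f -> e = f.
Proof.
move=> h1 h2; apply: val_inj.
by move: h1 h2; rewrite /rsrc /rdst; case: (val e) (val f) => [? ?] [? ?] /= -> ->.
Qed.

Lemma ordS_neq (i : 'I_m) : ordS i != i.
Proof. by apply/eqP => /(congr1 val); rewrite val_ordS; case: eqP => [|_] /=; lia. Qed.

Lemma ordSS_neq (i : 'I_m) : ordS (ordS i) != i.
Proof.
apply/eqP => /(congr1 val); rewrite !val_ordS; have := ltn_ord i.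
by case: eqP => [|_] /=; case: eqP => /=; lia.
Qed.

Lemma arc_irr u : ~~ arc u u.
Proof.
case: u => [[[j i] a]|t] //=; rewrite [i == _]eq_sym (negbTE (ordS_neq i)) andbF /=.
by apply/negP => /andP[/eqP]; lia.
Qed.

Lemma arc_asym u v : arc u v -> ~~ arc v u.
Proof.
case: u v => [[[j i] a]|t] [[[j' i'] b]|t'] //= /orP[/andP[/eqP -> /eqP ->]|].
  rewrite [i == _]eq_sym (negbTE (ordSS_neq i)) andbF /=.
  by apply/negP => /andP[/eqP]; lia.
move=> /andP[/eqP h _]; apply/negP => /orP[/andP[/eqP]|/andP[/eqP]].
  by move/(congr1 val) => /=; lia.
by lia.
Qed.

Lemma ring_simple : simple_graph rsrc rdst.
Proof.
split=> [e|e1 e2].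
  by apply/eqP => h; have := edge_arc e; rewrite h (negbTE (arc_irr _)).
case/orP => /andP[/eqP h1 /eqP h2]; first exact: redge_eq.
have := edge_arc e1; rewrite h1 h2 => /arc_asym.
by rewrite edge_arc.
Qed.

Lemma adjE u v : adj rsrc rdst u v = arc u v || arc v u.
Proof.
apply/existsP/orP => [[e /orP[]/andP[/eqP <- /eqP <-]]|[/arc_edge|/arc_edge] [e <- <-]].
- by left; exact: edge_arc.
- by right; exact: edge_arc.
- by exists e; rewrite !eqxx.
- by exists e; rewrite !eqxx orbT.
Qed.

Lemma sring_lt (t : 'I_p) : ((2 * r * t).+1 < N)%N.
Proof.
have h : (2 * r * t.+1 <= N)%N by rewrite leq_mul2l ltn_ord orbT.
by apply: leq_trans h; rewrite mulnS; lia.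
Qed.

(** * Connectivity after deleting fewer than [2 * q] vertices *)

Section Deletion.
Variable T : {set V}.
Hypothesis smallT : (#|T| < 2 * q)%N.
Local Notation con := (connect (del_rel rsrc rdst T)).

Lemma con_sym u v : con u v = con v u.
Proof.
apply: sym_connect_sym => x y; rewrite /del_rel !adjE orbC.
by rewrite [X in _ && X]andbC.
Qed.

Lemma con_arc u v : arc u v -> u \notin T -> v \notin T -> con u v.
Proof. by move=> a hu hv; apply: connect1; rewrite /del_rel adjE a hu hv. Qed.

Lemma con_trans_sym u v w : con v u -> con v w -> con u w.
Proof. by rewrite con_sym => h1 h2; exact: connect_trans h1 h2. Qed.

Lemma two_labels_free (f : bool -> 'I_q -> V) (g : V -> bool * 'I_q) :
  (forall b a, g (f b a) = (b, a)) -> exists b a, f b a \notin T.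
Proof.
move=> fg; have [|[b a] h] := @unused_label _ (bool * 'I_q)%type T g.
  by rewrite card_prod card_bool card_ord.
by exists b, a; apply: h; rewrite fg.
Qed.

(** Two fully deleted clusters would use up [2 * q] deleted vertices. If no cluster is fully
    deleted, any index can serve as [d]. *)
Lemma dead_cluster j : exists d, forall i, i != d -> exists a, rv j i a \notin T.
Proof.
have [[d dd]|nd] := pselect (exists d, forall a, rv j d a \in T); last first.
  exists ord0 => i _; apply: contrapT => h; apply: nd; exists i => a.
  by apply: contrapT => /negP h'; apply: h; exists a.
exists d => i id.
have [|b [a ba]] := @two_labels_free (fun b a => rv j (if b then d else i) a)
   (fun v => if v is inl (_, i', a) then (i' == d, a) else (true, ord0)).
  by move=> [] a; rewrite ?eqxx // (negbTE id).
by exists a; case: b ba => //; rewrite dd.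
Qed.

Lemma arcS j i a b : arc (rv j i a) (rv j (ordS i) b).
Proof. by rewrite /= !eqxx. Qed.

(** Cutting the ring open at the cluster [d] leaves a chain of clusters that all have a survivor,
    and consecutive clusters are completely joined. Survivors of [d] itself are attached to the
    first cluster of the chain. *)
Lemma ring_connected j i a i' a' :
  rv j i a \notin T -> rv j i' a' \notin T -> con (rv j i a) (rv j i' a').
Proof.
have [d dP] := dead_cluster j.
pose c t := iter t (@ordS m) d.
have cd t : (0 < t < m)%N -> c t != d.
  move=> /andP[t0 tm]; apply/eqP => /(congr1 val); rewrite val_iter_ordS.
  have := ltn_ord d; have [h|h] := ltnP (d + t) m; first by rewrite modn_small //=; lia.
  move=> dm; rewrite -(subnK h) modnDr modn_small /=; lia.
have [a0 x0] := dP _ (cd 1%N isT).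
set x := rv j (c 1%N) a0 in x0.
(* For [t = 0] the target is in the same cluster as [x]; both are joined to a survivor of the next
   cluster. *)
have main t b : (t.+1 < m)%N -> rv j (c t.+1) b \notin T -> con x (rv j (c t.+1) b).
  elim: t b => [|t IH] b tm bT.
    have [a2 x2] := dP _ (cd 2%N isT).
    apply: (connect_trans (y := rv j (c 2%N) a2)); first exact: con_arc (arcS _ _ _ _) _ _.
    by rewrite con_sym; exact: con_arc (arcS _ _ _ _) _ _.
  have [|a2 x2] := dP (c t.+1) _; first by apply: cd; lia.
  apply: connect_trans (IH _ _ x2) _; first by lia.
  exact: con_arc (arcS _ _ _ _) _ _.
have all k b : rv j k b \notin T -> con x (rv j k b).
  have -> : k = c ((k + (m - d)) %% m)%N.
    apply: val_inj; rewrite val_iter_ordS modnDmr.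
    have -> : (d + (k + (m - d)) = k + m)%N by have := ltn_ord d; lia.
    by rewrite modnDr modn_small.
  have : ((k + (m - d)) %% m < m)%N by rewrite ltn_mod.
  case: (_ %% m)%N => [_ bT|t tm bT]; last exact: main.
  by rewrite con_sym; apply: con_arc (arcS _ _ _ _) _ _.
by move=> h1 h2; apply: (con_trans_sym (all _ _ h1)); exact: all.
Qed.

(** The [2 * q] window columns, each running through all rings, are disjoint, so one of them
    survives entirely, and with it all its long edges. Vertices outside the windows get label 0,
    which does no harm. *)
Lemma free_window : exists2 i : 'I_m, (i < 2 * q)%N & forall j a, rv j i a \notin T.
Proof.
have q2 : (0 < 2 * q)%N by [].
pose lbl (v : V) := if v is inl (_, i, _) then insubd (Ordinal q2) (i : nat) else Ordinal q2.
have [|i iP] := @unused_label _ 'I_(2 * q) T lbl; first by rewrite card_ord.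
have im : (i < m)%N by have := ltn_ord i; lia.
exists (Ordinal im) => //= j a; apply: iP; apply: val_inj.
by rewrite /lbl /= val_insubd /= ltn_ord.
Qed.

Lemma corner_lt (b : bool) : ((if b then 2 * q else (2 * q).+1) < m)%N.
Proof. by case: b; rewrite ?ltnS ?leqnSn // leqW. Qed.

(** The ends of the top side of the triangle: [true] is the right corner, [false] the left one. *)
Definition top_corner (b : bool) : 'I_m := Ordinal (corner_lt b).

(** Here the labels are the [2 * q] places in the two top corners. The free place gives every
    surviving [s_t] a surviving neighbour in both of its rings. *)
Lemma free_corner : exists b a, forall j, rv j (top_corner b) a \notin T.
Proof.
pose lbl (v : V) := if v is inl (_, i, a) then (i == 2 * q :> nat, a)%N else (true, ord0).
have [|[b a] h] := @unused_label _ (bool * 'I_q)%type T lbl.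
  by rewrite card_prod card_bool card_ord.
exists b, a => j; apply: h; rewrite /lbl /=; case: b; rewrite ?eqxx //.
by congr pair; apply/eqP; lia.
Qed.

(** The representatives [w j] in a free window are linked by long edges among rings of equal parity,
    and [sv t] links an even ring to an odd one. Every other survivor reaches a representative
    through its ring, or through the free corner if it is some [s_t]. *)
Lemma deletion_connected (t : 'I_p) : sv t \notin T ->
  forall x y, x \notin T -> y \notin T -> con x y.
Proof.
move=> tT.
have [i iq iT] := free_window.
have [b [c cT]] := free_corner.
pose w j := rv j i ord0.
have wT j : w j \notin T by exact: iT.
have cw j : con (rv j (top_corner b) c) (w j) by exact: ring_connected.
have s_arc (s : 'I_p) (j : 'I_N) : (j == 2 * r * s :> nat)%N || (j == (2 * r * s).+1 :> nat)%N ->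
    arc (sv s) (rv j (top_corner b) c).
  by move=> /= ->; case: (b); rewrite eqxx ?orbT.
have step (j j' : 'I_N) : (val j' = val j + 2)%N -> con (w j) (w j').
  move=> jj; apply: (connect_trans (y := rv j i ord_max)); first exact: ring_connected.
  apply: con_arc => //=; rewrite !eqxx iq !andbT.
  by apply/orP; right; apply/eqP; rewrite /= jj addn2.
have steps n (j j' : 'I_N) : (val j' = val j + n.*2)%N -> con (w j) (w j').
  elim: n j' => [|n IH] j' jj.
    by have -> : j' = j by apply: val_inj; rewrite jj addn0.
  have jn : (val j + n.*2 < N)%N by have := ltn_ord j'; move: jj => /=; lia.
  apply: connect_trans (IH (Ordinal jn) erefl) _.
  by apply: step => /=; move: jj => /=; lia.
pose j0 : 'I_N := Ordinal (ltnW (sring_lt t)).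
pose j1 : 'I_N := Ordinal (sring_lt t).
have w01 : con (w j0) (w j1).
  apply: con_trans_sym (cw j0) _; apply: connect_trans _ (cw j1).
  apply: (con_trans_sym (v := sv t)); apply: con_arc => //; apply: s_arc => /=.
    by rewrite eqxx.
  by rewrite eqxx orbT.
have par (j j' : 'I_N) : odd j = odd j' -> con (w j) (w j').
  wlog jj : j j' / (j <= j')%N.
    by move=> H o; have [h|/ltnW h] := leqP j j'; [exact: H|rewrite con_sym; apply: H].
  move=> o; apply: (steps ((j' - j)./2)%N).
  rewrite halfK oddB // o addbb subn0; move: jj => /=; lia.
have wall j : con (w j) (w j0).
  have [jo|jo] := boolP (odd j == odd j0); first exact/par/eqP.
  rewrite con_sym; apply: connect_trans w01 _; rewrite con_sym; apply: par.
  by move: jo; rewrite /= !oddM /=; case: (odd j).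
have all x : x \notin T -> con (w j0) x.
  case: x => [[[j k] a]|s] xT.
    apply: (con_trans_sym (wall j)); exact: ring_connected.
  pose js : 'I_N := Ordinal (ltnW (sring_lt s)).
  apply: (con_trans_sym (wall js)); apply: con_trans_sym (cw js) _.
  rewrite con_sym; apply: con_arc => //; apply: s_arc; by rewrite eqxx.
by move=> x y xT yT; apply: (con_trans_sym (all x xT)); exact: all.
Qed.

End Deletion.

(** * The unique minimum vertex cut *)

Definition spokes : {set V} := [set inr t | t : 'I_p]%SET.

Lemma card_spokes : #|spokes| = p.
Proof. by rewrite card_imset ?card_ord // => x y []. Qed.

(** Without the vertices [s_t], every edge preserves the parity of the ring index, so rings 0 and 1
    are separated. *)
Lemma spokes_cut : vertex_cut rsrc rdst spokes.
Proof.
have N0 : (0 < N)%N by rewrite !muln_gt0 r0 p0.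
have N1 : (1 < N)%N by move: N0; lia.
exists (rv (Ordinal N0) ord0 ord0), (rv (Ordinal N1) ord0 ord0); split.
- by apply/imsetP => -[].
- by apply/imsetP => -[].
apply/negP => /closed_connect H.
pose P : pred V := fun v : V => if v is inl (j, _, _) then odd j else false.
suff /H : fingraph.closed (del_rel rsrc rdst spokes) P by [].
move=> x y /and3P[]; rewrite adjE => xy xS yS.
have nS t : inr t \notin spokes -> False by move/negP; apply; apply/imsetP; exists t.
case: x y xy xS yS => [[[j i] a]|t] [[[j' i'] a']|t'] xy xS yS;
  try by [case: (nS _ xS)|case: (nS _ yS)].
move: xy; rewrite -!topredE /P /= => /orP[] /orP[/andP[/eqP -> _]//|/andP[/eqP -> _]];
  by rewrite /= negbK.
Qed.

(** A cut of size at most [p] that misses some [s_t] would contradict [deletion_connected]; one that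
    contains them all equals [spokes] by cardinality. *)
Lemma spokes_unique_min : (p < 2 * q)%N -> unique_min_vertex_cut rsrc rdst spokes.
Proof.
move=> pq.
have H T : vertex_cut rsrc rdst T -> (#|T| <= p)%N -> T = spokes.
  move=> [x [y [xT yT xy]]] Tp; apply: contrapT => TS; move/negP: xy; apply.
  have [[t tT]|nt] := pselect (exists t, sv t \notin T).
    by apply: deletion_connected tT x y xT yT; exact: leq_ltn_trans Tp pq.
  exfalso; apply: TS; apply/esym/eqP; rewrite eqEcard card_spokes Tp andbT.
  apply/fintype.subsetP => _ /imsetP[t _ ->]; apply: contrapT => /negP tT; apply: nt; by exists t.
split; first split; first exact: spokes_cut.
  move=> T cT; have [h|/ltnW//] := leqP #|T| #|spokes|.
  by rewrite (H T) //; apply: leq_trans h _; rewrite card_spokes.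
move=> T [cT minT]; apply: H => //.
by apply: leq_trans (minT _ spokes_cut) _; rewrite card_spokes.
Qed.


(** * Nominal positions *)

Definition rqty : RR := q%:R.
(** The spacing [q + 3] accommodates the [q] places of a cluster and a vertex [s_t] midway between
    two rings. The offset [4 * q + 4] keeps all window heights, at most [4 * q - 1], below the top
    side. *)
Definition rad (j : nat) : RR := ((q + 3) * j + 4 * q + 4)%:R.
(** Windows of even and odd rings have interleaved heights, so a horizontal long edge passes between
    two clusters of the ring that it skips. *)
Definition hgt (j i : nat) : RR := (2 * i + odd j)%:R.

Lemma rqty_ge2 : 2 <= rqty.
Proof. by rewrite /rqty ler_nat. Qed.

Lemma rad_ge j : 4 * rqty + 4 <= rad j.
Proof.
have -> : 4 * rqty + 4 = (4 * q + 4)%:R :> RR by rewrite natrD natrM.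
by rewrite /rad ler_nat; lia.
Qed.

Lemma radS j : rad j.+1 = rad j + rqty + 3.
Proof. by rewrite /rad /rqty -!natrD; congr _%:R; rewrite mulnS; lia. Qed.

Lemma rad_lt j j' : (j < j')%N -> rad j + rqty + 3 <= rad j'.
Proof.
by move=> jj; rewrite -radS /rad ler_nat !leq_add2r leq_mul2l jj orbT.
Qed.

Lemma ord_real (a : 'I_q) : 0 <= a%:R :> RR /\ a%:R <= rqty - 1.
Proof.
split; first exact: ler0n.
by rewrite lerBrDr /rqty natr1 ler_nat; have := ltn_ord a; lia.
Qed.

Lemma hgt_ge0 j i : 0 <= hgt j i.
Proof. exact: ler0n. Qed.

Lemma hgt_le j i : (i < 2 * q)%N -> hgt j i <= 4 * rqty - 1.
Proof.
move=> iq; rewrite lerBrDr.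
have -> : 4 * rqty = (4 * q)%:R :> RR by rewrite natrM.
by rewrite /hgt natr1 ler_nat; case: (odd j); lia.
Qed.

Lemma hgt_lt j i i' : (i < i')%N -> hgt j i + 2 <= hgt j i'.
Proof. by move=> ii; rewrite /hgt -natrD ler_nat; lia. Qed.

Lemma hgtSS j i : hgt j.+2 i = hgt j i.
Proof. by rewrite /hgt /= negbK. Qed.

Lemma hgt_between j i : if odd j then hgt j.+1 i + 1 = hgt j i
  else hgt j i + 1 = hgt j.+1 i.
Proof.
by rewrite /hgt /=; case: (odd j) => /=; rewrite natr1; congr _%:R; lia.
Qed.

(** The vertex [(j, i, a)] lies on the triangle where the maximum of [x], [y] and [-x-y] is
    [rad j + a]: either on its right side or at a corner. The vertices [s_t] lie just above the
    middle part of a top side. *)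
Definition nominal (v : V) : plane :=
  match v with
  | inl (j, i, a) =>
      if (i < 2 * q)%N then (rad j + a%:R, hgt j i)
      else if i == 2 * q :> nat then (rad j + a%:R, rad j + a%:R)
      else if i == (2 * q).+1 :> nat then (- 2 * (rad j + a%:R), rad j + a%:R)
      else (rad j + a%:R, - 2 * (rad j + a%:R))
  | inr t => (0, rad (2 * r * t) + rqty + 1)
  end.

(** Coordinates are of order [rad N], so even [eps] times the size of the drawing is a small
    fraction of the unit spacing. *)
Definition eps : RR := (200 * rad N)^-1.

Definition innermost : pred V := fun v => if v is inl (_, _, a) then a == ord0 else false.

(* phi j i vanishes on the i-th cluster of ring j, is at most -1 on the previous cluster and at
   least 1 on the next one; sgm is the radial coordinate along the line phi = 0. *)
Definition phi (j i : nat) (z : plane) : RR :=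
  if (i < 2 * q)%N then z.2 - hgt j i
  else if i == 2 * q then z.2 - z.1
  else if i == (2 * q).+1 then - z.1 - 2 * z.2
  else 2 * z.1 + z.2.

Definition sgm (i : nat) (z : plane) : RR := if i == (2 * q).+1 then z.2 else z.1.

(* The gap after the i-th cluster of ring j lies along the line side i = rad j. *)
Definition side (i : nat) (z : plane) : RR :=
  if i == 2 * q then z.2 else if i == (2 * q).+1 then - z.1 - z.2 else z.1.

Lemma phi_lin j i u w t : phi j i (lin u w t) = (1 - t) * phi j i u + t * phi j i w.
Proof. by rewrite /phi /lin; case: ifP => _; [|case: ifP => _; [|case: ifP => _]] => /=; ring. Qed.

Lemma sgm_lin i u w t : sgm i (lin u w t) = (1 - t) * sgm i u + t * sgm i w.
Proof. by rewrite /sgm /lin; case: ifP. Qed.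

Lemma side_lin i u w t : side i (lin u w t) = (1 - t) * side i u + t * side i w.
Proof. by rewrite /side /lin; case: ifP => _; [|case: ifP => _] => //=; ring. Qed.

Lemma lin_ge (c x y t : RR) : 0 <= t <= 1 -> c <= x -> c <= y -> c <= (1 - t) * x + t * y.
Proof. by move=> /andP[? ?] ? ?; nra. Qed.

Lemma lin_le (c x y t : RR) : 0 <= t <= 1 -> x <= c -> y <= c -> (1 - t) * x + t * y <= c.
Proof. by move=> /andP[? ?] ? ?; nra. Qed.

Lemma eps_gt0 : 0 < eps.
Proof.
by rewrite invr_gt0; have := rad_ge N; have := rqty_ge2; lra.
Qed.

Lemma eps_rad : 200 * (eps * rad N) = 1.
Proof.
have h : 200 * rad N != 0.
  by apply: lt0r_neq0; have := rad_ge N; have := rqty_ge2; lra.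
by rewrite mulrCA /eps; exact: mulVf.
Qed.

Lemma eps_small : 16 * eps <= 1.
Proof.
have := eps_rad; have := eps_gt0; have := rad_ge N; have := rqty_ge2 => *; nra.
Qed.

(* A point of a segment at which phi is tiny is near the end where phi vanishes. *)
Lemma near_end (fv fw sv' sw t : RR) : 0 <= t <= 1 ->
  - 3 * eps <= fv <= 3 * eps -> 1 <= fw -> (1 - t) * fv + t * fw <= 3 * eps ->
  - 2 * rad N <= sv' <= 2 * rad N -> - 2 * rad N <= sw <= 2 * rad N ->
  sv' - 1/4 <= (1 - t) * sv' + t * sw <= sv' + 1/4.
Proof.
move=> /andP[t0 t1] /andP[f0 f1] fw1 fz /andP[s0 s1] /andP[w0 w1].
have e0 := eps_gt0; have e1 := eps_rad; have e2 := eps_small.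
(* The hypotheses give [t * (1 + 3 * eps) <= 6 * eps]. The displacement is at most
   [t * (4 * rad N)], and the factor 200 in [eps] bounds this by [48 / 200 < 1 / 4]. *)
have tb : t <= 12 * eps by nra.
have R0 : 0 <= rad N by have := rad_ge N; have := rqty_ge2; lra.
have h1 : t * (4 * rad N) <= 48 / 200 by nra.
by apply/andP; split; nra.
Qed.

Lemma rad_ltN (j : 'I_N) (a : 'I_q) : rad j + a%:R + 4 <= rad N.
Proof. by have := rad_lt (ltn_ord j); have := ord_real a; lra. Qed.

Lemma cornerE : (((2 * q).+1 == m) = false) * (((2 * q).+1 < 2 * q)%N = false) *
  (((2 * q).+1 == 2 * q)%N = false) * (((2 * q).+2 == m) = false) *
  (((2 * q).+2 < 2 * q)%N = false) * (((2 * q).+2 == 2 * q)%N = false) *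
  (((2 * q).+2 == (2 * q).+1)%N = false).
Proof. by do !split; lia. Qed.

Lemma last_corner i : (i < m)%N -> (2 * q <= i)%N -> i <> (2 * q)%N -> i <> (2 * q).+1 ->
  (i.+1 == m) = true.
Proof. by move=> *; lia. Qed.

Lemma last_window i : (i < 2 * q)%N -> (2 * q <= i.+1)%N -> (i.+1 == 2 * q)%N = true.
Proof. by move=> *; lia. Qed.

Lemma window_neq i : (i < 2 * q)%N -> (i.+1 == m) = false.
Proof. by move=> *; lia. Qed.


Lemma other_ord (a : 'I_q) : exists b : 'I_q, b != a.
Proof.
exists (if a == ord0 then ord_max else ord0).
by case: (a =P ord0) => [->//|/eqP]; rewrite eq_sym.
Qed.

(** * Combinatorial types of edges and crossings *)

Definition spoke_rings (t : 'I_p) (j : 'I_N) : Prop :=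
  (j = 2 * r * t :> nat)%N \/ (j = (2 * r * t).+1 :> nat)%N.

(* C, L and S stand for edges between consecutive clusters, long edges, and edges at some s_t. *)
Inductive edge_kind (u v : V) : Prop :=
| ClusterEdge (j : 'I_N) (i : 'I_m) (a b : 'I_q) of
    u = rv j i a & v = rv j (ordS i) b
| LongEdge (j j' : 'I_N) (i : 'I_m) of val j' = j.+2 & (i < 2 * q)%N &
    u = rv j i ord_max & v = rv j' i ord0
| SpokeEdge (t : 'I_p) (j : 'I_N) (c : bool) (a : 'I_q) of spoke_rings t j &
    u = sv t & v = rv j (top_corner c) a.

Lemma arcP u v : arc u v -> edge_kind u v.
Proof.
case: u v => [[[j i] a]|t] [[[j' i'] b]|t'] //=.
  case/orP=> [/andP[/eqP -> /eqP ->]|/and5P[/eqP jj /eqP -> iq /eqP -> /eqP ->]].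
  exact: (@ClusterEdge _ _ j i a b).
  exact: (@LongEdge _ _ j j' i).
case/andP => jt it; apply: (@SpokeEdge _ _ t j' (i' == 2 * q :> nat)%N b) => //.
  by case/orP: jt => /eqP; [left|right].
by congr (inl (_, _, _)); apply: val_inj => /=; case: eqP it => //= _ /eqP.
Qed.

(** The parity condition in [CrossLC] names the gap of ring [j.+1] that contains the height
    [hgt j i]. The inequalities in [CrossCC] and [CrossSC] say that the edges share no end. *)
Inductive cross_kind (u v u' v' : V) : Prop :=
| CrossCC (j : 'I_N) (i : 'I_m) (a b a' b' : 'I_q) of a != a' & b != b' &
    u = rv j i a & v = rv j (ordS i) b & u' = rv j i a' & v' = rv j (ordS i) b'
| CrossLC (j j' j1 : 'I_N) (i i1 : 'I_m) (a b : 'I_q) of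
    (i < 2 * q)%N & val j1 = j.+1 & (if odd j then i1 = i else ordS i1 = i) &
    [/\ u = rv j i ord_max, v = rv j' i ord0 & val j' = j.+2] &
    u' = rv j1 i1 a & v' = rv j1 (ordS i1) b
| CrossSC (t : 'I_p) (j : 'I_N) (c : bool) (a0 a b : 'I_q) of
    spoke_rings t j & (if c then a0 != a else a0 != b) &
    u = sv t & v = rv j (top_corner c) a0 &
    u' = rv j (top_corner true) a & v' = rv j (ordS (top_corner true)) b.

Lemma ordS_top : ordS (top_corner true) = top_corner false.
Proof. by apply: val_inj; rewrite val_ordS /= !cornerE. Qed.

Definition vdisjoint (u v u' v' : V) := [/\ u <> u', u <> v', v <> u' & v <> v'].

Lemma vdisjointC u v u' v' : vdisjoint u v u' v' -> vdisjoint u' v' u v.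
Proof. by case=> *; split=> /esym. Qed.

Lemma ordS_pred (i : 'I_m) : exists i', ordS i' = i.
Proof. by exists (ord_pred i); rewrite ord_predK. Qed.


Definition label (v : V) : 'I_q := if v is inl (_, _, a) then a else ord0.

(* Injective on the edges (u', v') crossing a given edge (u, v), whose number is therefore at
   most q^2. *)
Definition cross_code (u v u' v' : V) : 'I_q * 'I_q :=
  match u', v' with
  | inl (j', _, a'), inl (j'', _, b') => if j' == j'' then (a', b') else (label u, label v)
  | inr _, inl (_, i', a') => if i' == 2 * q :> nat then (a', label v) else (label u, a')
  | _, _ => (ord0, ord0)
  end.

Definition may_cross u v u' v' := cross_kind u v u' v' \/ cross_kind u' v' u v.

Lemma long_neq (j j' : 'I_N) : val j' = j.+2 -> (j == j') = false.
Proof. by move=> h; apply/negP => /eqP jj; move: h; rewrite jj /=; clear; lia. Qed.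

Lemma cross_cluster (j : 'I_N) (i : 'I_m) (a b : 'I_q) u' v' :
  may_cross (rv j i a) (rv j (ordS i) b) u' v' ->
  [\/ exists a' b', [/\ a' != a, b' != b, u' = rv j i a' & v' = rv j (ordS i) b'],
      exists (k k' : 'I_N) (l : 'I_m), [/\ val j = k.+1, val k' = k.+2,
        if odd k then i = l else ordS i = l &
        [/\ (l < 2 * q)%N, u' = rv k l ord_max & v' = rv k' l ord0]] |
      exists t c a0, [/\ spoke_rings t j, i = top_corner true, if c then a0 != a else a0 != b &
        u' = sv t /\ v' = rv j (top_corner c) a0]].
Proof.
case=> -[].
- move=> j1 i1 a1 b1 a1' b1' aa bb [jE iE aE] [_ _ bE] -> ->; subst.
  by constructor 1; exists a1', b1'; rewrite eq_sym aa eq_sym bb.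
- move=> k k' j1 i1 i2 a1 b1 _ _ _ [[jE _ _] [jE' _ _] kk]; subst.
  by have := long_neq kk; rewrite eqxx.
- by [].
- move=> j1 i1 a1 b1 a1' b1' aa bb -> -> [jE iE aE] [_ _ bE]; subst.
  by constructor 1; exists a1, b1.
- move=> k k' j1 l i1 a1 b1 lq jk il [-> -> kk] [jE iE aE] [_ _ bE]; subst.
  by constructor 2; exists k, k', l.
- move=> t j1 c a0 a1 b1 jt ca -> -> [jE iE aE] [_ _ bE]; subst.
  by constructor 3; exists t, c, a0.
Qed.

Lemma cross_long (j j' : 'I_N) (i : 'I_m) u' v' : val j' = j.+2 ->
  may_cross (rv j i ord_max) (rv j' i ord0) u' v' ->
  exists (j1 : 'I_N) i1 a b, [/\ val j1 = j.+1, if odd j then i1 = i else ordS i1 = i,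
    u' = rv j1 i1 a & v' = rv j1 (ordS i1) b].
Proof.
move=> jj; case=> -[].
- move=> j1 i1 a1 b1 a1' b1' _ _ [jE _ _] [jE' _ _]; subst.
  by have := long_neq jj; rewrite eqxx.
- move=> k k' j1 l i1 a1 b1 _ jk il [[jE lE] [_ _] _] -> ->; subst.
  by exists j1, i1, a1, b1.
- by [].
- move=> j1 i1 a1 b1 a1' b1' _ _ _ _ [jE _ _] [jE' _ _]; subst.
  by have := long_neq jj; rewrite eqxx.
- move=> k k' j1 l i1 a1 b1 _ _ _ _ [jE _ _] [jE' _ _]; subst.
  by have := long_neq jj; rewrite eqxx.
- move=> t j1 c a0 a1 b1 _ _ _ _ [jE _ _] [jE' _ _]; subst.
  by have := long_neq jj; rewrite eqxx.
Qed.

Lemma cross_spoke (t : 'I_p) (j : 'I_N) c (a0 : 'I_q) u' v' :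
  may_cross (sv t) (rv j (top_corner c) a0) u' v' ->
  exists a b, u' = rv j (top_corner true) a /\ v' = rv j (ordS (top_corner true)) b.
Proof.
case=> -[] //.
- by move=> k k' j1 l i1 a1 b1 _ _ _ [].
- by move=> t1 j1 c1 a1 a b _ _ _ [jE _ _] -> ->; subst; exists a, b.
Qed.

Lemma spoke_rings_inj (t t' : 'I_p) (j : 'I_N) : spoke_rings t j -> spoke_rings t' j -> t = t'.
Proof.
wlog tt : t t' / (t <= t')%N.
  move=> H *; have [h|/ltnW h] := leqP t t'; first exact: H.
  by apply/esym; exact: H.
move=> jt jt'; apply: val_inj; apply/eqP; rewrite eqn_leq tt leqNgt; apply/negP => lt.
have h : (2 * r * t.+1 <= 2 * r * t')%N by rewrite leq_mul2l lt orbT.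
have h2 : ((2 * r * t).+1 < 2 * r * t')%N.
  by apply: leq_trans h; rewrite mulnS; clear -r0; lia.
have {jt} jt : (j <= (2 * r * t).+1)%N by case: jt => ->; clear; lia.
have {jt'} jt' : (2 * r * t' <= j)%N by case: jt' => ->; clear; lia.
by have := leq_ltn_trans (leq_trans jt' jt) h2; rewrite ltnn.
Qed.

(** For a cluster edge with places [(a, b)], crossing cluster edges differ from it in both places,
    edges at [s_t] have a code that differs in exactly one, and the long edge, unique in its gap,
    has code [(a, b)]. Long edges and edges at [s_t] cross cluster edges of one gap only, which are
    determined by their places. *)
Lemma cross_code_inj u v u1 v1 u2 v2 : arc u v ->
  may_cross u v u1 v1 -> may_cross u v u2 v2 ->
  cross_code u v u1 v1 = cross_code u v u2 v2 -> u1 = u2 /\ v1 = v2.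
Proof.
move=> /arcP [j i a b -> ->|j j' i jj iq -> ->|t j c a0 jt -> ->]; first last.
- move=> /cross_spoke [a1 [b1 [-> ->]]] /cross_spoke [a2 [b2 [-> ->]]].
  by rewrite /cross_code !eqxx => -[-> ->].
- move=> /(cross_long jj) [j1 [i1 [a1 [b1 [h1 h2 -> ->]]]]].
  move=> /(cross_long jj) [j2 [i2 [a2 [b2 [k1 k2 -> ->]]]]].
  rewrite /cross_code !eqxx => -[-> ->].
  have -> : j1 = j2 by apply: val_inj; rewrite h1 k1.
  suff -> : i1 = i2 by [].
  by case: (odd j) h2 k2 => [-> ->//|<-]; move/(can_inj (@ordSK _)).
have topq c : (top_corner c == (2 * q)%N :> nat) = c.
  by case: c => /=; rewrite ?eqxx ?cornerE.
(* The gap along the top side is crossed by no long edge. *)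
have RL (k : nat) (l : 'I_m) : (l < 2 * q)%N -> i = top_corner true ->
    (if odd k then i = l else ordS i = l) -> False.
  move=> lq -> ; rewrite ordS_top; case: ifP => _ h; move: lq; rewrite -h /= ?ltnn //.
  by rewrite !cornerE.
move=> /cross_cluster [[a1 [b1 [n1 n1' -> ->]]]
  |[k [k' [l [jk kk il [lq -> ->]]]]]|[t [c [a0 [jt iE nc [-> ->]]]]]];
move=> /cross_cluster [[a2 [b2 [n2 n2' -> ->]]]
  |[k2 [k2' [l2 [jk2 kk2 il2 [lq2 -> ->]]]]]|[t2 [c2 [a2 [jt2 iE2 nc2 [-> ->]]]]]];
  rewrite /cross_code /= ?eqxx ?(long_neq kk) ?(long_neq kk2) ?topq.
- by case=> -> ->.
- by case=> h; move: n1; rewrite h eqxx.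
- case: c2 nc2 => nc2 [h1 h2]; first by move: n1'; rewrite h2 eqxx.
  by move: n1; rewrite h1 eqxx.
- by case=> h; move: n2; rewrite -h eqxx.
- move=> _; have kE : k = k2 by apply: val_inj; move: jk jk2 => /=; lia.
  subst k2; have kE' : k' = k2' by apply: val_inj; rewrite kk kk2.
  by subst k2'; case: (odd k) il il2 => -> ->.
- by exfalso; exact: RL lq iE2 il.
- case: c nc => nc [h1 h2]; first by move: n2'; rewrite -h2 eqxx.
  by move: n2; rewrite -h1 eqxx.
- by exfalso; exact: RL lq2 iE il2.
- rewrite (spoke_rings_inj jt jt2).
  case: c c2 nc nc2 => -[] nc nc2 [h1] //.
  + by rewrite h1.
  + by move: nc; rewrite h1 eqxx.
  + by move: nc2; rewrite -h1 eqxx.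
  + by rewrite h1.
Qed.

(** * The triangular gauge and coverings of its sides *)

Definition gauge (z : plane) : RR := Num.max z.1 (Num.max z.2 (- z.1 - z.2)).

Lemma gauge_continuous : continuous gauge.
Proof.
move=> z; apply: (@continuous_max _ _ (fun z : plane => z.1)).
  exact: cvg_fst.
apply: (@continuous_max _ _ (fun z : plane => z.2) (fun z : plane => - z.1 - z.2)).
  exact: cvg_snd.
by apply: cvgB; [apply: cvgN; exact: cvg_fst|exact: cvg_snd].
Qed.

Lemma gauge_le c z : (gauge z <= c) = [&& z.1 <= c, z.2 <= c & - z.1 - z.2 <= c].
Proof. by rewrite /gauge !ge_max. Qed.

Lemma gauge_eq c z : gauge z = c ->
  [/\ z.1 <= c, z.2 <= c, - z.1 - z.2 <= c & [\/ z.1 = c, z.2 = c | - z.1 - z.2 = c]].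
Proof.
move=> h; have /and3P[h1 h2 h3] : [&& z.1 <= c, z.2 <= c & - z.1 - z.2 <= c].
  by rewrite -gauge_le h.
split=> //; move: h; rewrite /gauge /Order.max; case: ifP => _; last by constructor 1.
by case: ifP => _; [constructor 3|constructor 2].
Qed.

Lemma seg_vertical (x y1 y2 y : RR) : y1 <= y <= y2 -> seg (x, y1) (x, y2) (x, y).
Proof.
move=> /andP[h1 h2]; have [h|h] := eqVneq y1 y2.
  have -> : y = y1 by lra.
  exact: segl.
have d : 0 < y2 - y1 by rewrite subr_gt0 lt_neqAle h; exact: le_trans h1 h2.
exists ((y - y1) / (y2 - y1)).
  by rewrite divr_ge0 ?subr_ge0 //= ?ler_pdivrMr //; lra.
rewrite /lin /=; congr pair; first by ring.
by field; rewrite gt_eqF.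
Qed.

(** A discrete intermediate value theorem, for a sequence that need not be monotone. *)
Lemma chain_cover (f : nat -> RR) n y : f 0%N <= y <= f n ->
  (0 < n)%N -> exists2 k, (k < n)%N & f k <= y <= f k.+1.
Proof.
elim: n => [//|n IH] /andP[h0 hn] _.
have [h|h] := lerP (f n) y; first by exists n => //; rewrite h hn.
have [n0|n0] := posnP n; first by exists 0%N => //; rewrite h0 /=; move: hn; rewrite n0.
by have [|//|k kn hk] := IH _; [rewrite h0 ltW|exists k => //; rewrite ltnW].
Qed.

(** * Crossings *)

Section Position.
Variable pos : V -> plane.
Hypothesis adm : admissible nominal eps innermost pos.

Lemma pos_near v :
  [/\ - eps <= (pos v).1 - (nominal v).1, (pos v).1 - (nominal v).1 <= eps,
      - eps <= (pos v).2 - (nominal v).2 & (pos v).2 - (nominal v).2 <= eps].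
Proof.
by have [h1 h2 _] := adm v; move: h1 h2; rewrite !ler_norml => /andP[? ?] /andP[? ?].
Qed.

(** [phi j i] vanishes at the nominal position, and its two coefficients have absolute values of sum
    at most 3. *)
Lemma phi_at (j : 'I_N) (i : 'I_m) (a : 'I_q) : - 3 * eps <= phi j i (pos (rv j i a)) <= 3 * eps.
Proof.
have := eps_gt0; have := pos_near (rv j i a); rewrite /nominal /phi.
by case: ifP => _; [|case: ifP => _; [|case: ifP => _]] => /= -[]; lra.
Qed.

Lemma sgm_at (j : 'I_N) (i : 'I_m) (a : 'I_q) :
  rad j + a%:R - eps <= sgm i (pos (rv j i a)) <= rad j + a%:R + eps.
Proof.
have := pos_near (rv j i a); rewrite /nominal /sgm.
case: ifP => [iq|_]; first by rewrite ltn_eqF ?(ltn_trans iq) // => -[] /=; lra.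
case: ifP => [/eqP ->|_]; first by rewrite ltn_eqF // => -[] /=; lra.
by case: ifP => _ -[] /=; lra.
Qed.

Lemma sgm_bound (i : 'I_m) (j : 'I_N) (k : nat) (a : 'I_q) :
  - 2 * rad N <= sgm k (pos (rv j i a)) <= 2 * rad N.
Proof.
have := pos_near (rv j i a); rewrite /nominal /sgm.
have := rad_ltN j a; have := ord_real a; have := rad_ge j; have := rqty_ge2.
have := eps_small; have := eps_gt0.
move=> ? ? ? ? [? ?] ?; case: ifP => [iq|_].
  by have := hgt_le j iq; have := hgt_ge0 j i; case: ifP => _ ? ? [] /=; lra.
by case: ifP => _; [|case: ifP => _]; case: ifP => _ [] /=; lra.
Qed.

Lemma phi_next (j : 'I_N) (i : 'I_m) (b : 'I_q) : 1 <= phi j i (pos (rv j (ordS i) b)).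
Proof.
have := pos_near (rv j (ordS i) b); rewrite /nominal /phi val_ordS.
have := ord_real b; have := rad_ge j; have := rqty_ge2.
have := eps_small; have := eps_gt0.
move=> e0 e1 ? ? [? ?]; have im := ltn_ord i.
case: (ltnP i (2 * q)) => iq.
  rewrite (window_neq iq).
  case: (ltnP i.+1 (2 * q)) => iq'.
    by have := hgt_lt j (ltnSn i) => ? [] /=; lra.
  rewrite (last_window iq iq').
  by have := hgt_le j iq => ? [] /=; lra.
case: (i =P (2 * q)%N :> nat) => [-> |ni].
  rewrite !cornerE ?eqxx.
  by case=> /=; lra.
case: (i =P (2 * q).+1 :> nat) => [-> |ni'].
  rewrite !cornerE ?eqxx.
  by case=> /=; lra.
rewrite (last_corner im iq ni ni').
by have := hgt_ge0 j 0 => ? [] /=; lra.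
Qed.

Lemma phi_prev (j : 'I_N) (i : 'I_m) (a : 'I_q) : phi j (ordS i) (pos (rv j i a)) <= -1.
Proof.
have := pos_near (rv j i a); rewrite /nominal /phi val_ordS.
have := ord_real a; have := rad_ge j; have := rqty_ge2.
have := eps_small; have := eps_gt0.
move=> e0 e1 ? ? [? ?]; have im := ltn_ord i.
case: (ltnP i (2 * q)) => iq.
  rewrite (window_neq iq).
  case: (ltnP i.+1 (2 * q)) => iq'.
    by have := hgt_lt j (ltnSn i) => ? [] /=; lra.
  rewrite (last_window iq iq').
  by have := hgt_le j iq => ? [] /=; lra.
case: (i =P (2 * q)%N :> nat) => [-> |ni].
  rewrite !cornerE ?eqxx.
  by case=> /=; lra.
case: (i =P (2 * q).+1 :> nat) => [-> |ni'].
  rewrite !cornerE ?eqxx.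
  by case=> /=; lra.
rewrite (_ : (i.+1 == m) = true); last by lia.
by rewrite /= ; have := hgt_ge0 j 0 => ? [] /=; lra.
Qed.

Lemma side_at (j : 'I_N) (i : 'I_m) (a : 'I_q) : rad j - 3 * eps <= side i (pos (rv j i a)).
Proof.
have := pos_near (rv j i a); rewrite /nominal /side.
have := ord_real a; have := eps_gt0; move=> ? [? ?].
case: ifP => [iq|_].
  rewrite ifF; last by lia.
  rewrite ifF; last by lia.
  by case=> /=; lra.
by case: ifP => [_|_]; [|case: ifP => _]; case=> /=; lra.
Qed.

Lemma side_next (j : 'I_N) (i : 'I_m) (a : 'I_q) :
  rad j - 3 * eps <= side i (pos (rv j (ordS i) a)).
Proof.
have := pos_near (rv j (ordS i) a); rewrite /nominal /side val_ordS.
have := ord_real a; have := eps_gt0; move=> ? [? ?]; have im := ltn_ord i.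
case: (i =P (2 * q)%N :> nat) => [-> |ni].
  rewrite !cornerE ?eqxx.
  by case=> /=; lra.
case: (i =P (2 * q).+1 :> nat) => [-> |ni'].
  rewrite !cornerE ?eqxx.
  by case=> /=; lra.
case: (i.+1 =P m) => [_|im'] /=; first by case=> /=; lra.
case: ifP => [_|/negbT h]; first by case=> /=; lra.
have -> : (i.+1 == 2 * q)%N by apply/eqP; lia.
by case=> /=; lra.
Qed.

Definition within (c : RR) (z : plane) := [/\ z.1 <= c, z.2 <= c & - z.1 - z.2 <= c].

Lemma within_at (j : 'I_N) (i : 'I_m) (a : 'I_q) :
  within (rad j + rqty - 1 + 3 * eps) (pos (rv j i a)).
Proof.
have := pos_near (rv j i a); rewrite /nominal.
have := ord_real a; have := eps_gt0; have := rad_ge j; have := rqty_ge2.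
move=> ? ? ? [? ?]; rewrite /within.
case: ifP => [iq|_].
  by have := hgt_ge0 j i; have := hgt_le j iq => ? ? [] /=; split; lra.
by case: ifP => [_|_]; [|case: ifP => _]; case=> /=; split; lra.
Qed.

Lemma within_lin c u w t : 0 <= t <= 1 -> within c u -> within c w -> within c (lin u w t).
Proof.
move=> t01 [h1 h2 h3] [k1 k2 k3]; split; rewrite /lin /=; try exact: lin_le.
have := lin_le t01 h3 k3; lra.
Qed.

Lemma within_side c i z : within c z -> side i z <= c.
Proof. by case=> *; rewrite /side; case: ifP => _ //; case: ifP. Qed.

(** These linear inequalities hold at both ends, hence along the edge; they confine it to its gap.
    Near either end the radial coordinate reveals the place of the end: the error is 1/4 from
    [near_end] plus [eps], below 1/3. *)
Lemma cedge_facts (j : 'I_N) (i : 'I_m) (a b : 'I_q) z :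
  seg (pos (rv j i a)) (pos (rv j (ordS i) b)) z ->
  [/\ - 3 * eps <= phi j i z, phi j (ordS i) z <= 3 * eps,
      rad j - 3 * eps <= side i z & within (rad j + rqty - 1 + 3 * eps) z] /\
  (phi j i z <= 3 * eps -> rad j + a%:R - 1/3 <= sgm i z <= rad j + a%:R + 1/3) /\
  (- 3 * eps <= phi j (ordS i) z ->
     rad j + b%:R - 1/3 <= sgm (ordS i) z <= rad j + b%:R + 1/3).
Proof.
case=> t t01 ->; have e0 := eps_gt0; have e1 := eps_small; split.
  rewrite !phi_lin side_lin; split.
  - apply: lin_ge => //; first by case/andP: (phi_at j i a).
    by have := phi_next j i b; lra.
  - apply: lin_le => //; last by case/andP: (phi_at j (ordS i) b).
    by have := phi_prev j i a; lra.
  - by apply: lin_ge => //; [exact: side_at|exact: side_next].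
  - by apply: within_lin => //; exact: within_at.
split.
  rewrite phi_lin sgm_lin => h.
  have := near_end t01 (phi_at j i a) (phi_next j i b) h (sgm_bound i j i a)
     (sgm_bound (ordS i) j i b).
  by have := sgm_at j i a; lra.
rewrite phi_lin sgm_lin => h.
(* For the other end, [near_end] is applied to the reversed edge and to [- phi]. *)
have t01' : 0 <= 1 - t <= 1 by lra.
have /andP[k1 k2] := phi_at j (ordS i) b; have k3 := phi_prev j i a.
have := @near_end (- phi j (ordS i) (pos (rv j (ordS i) b))) (- phi j (ordS i) (pos (rv j i a)))
  (sgm (ordS i) (pos (rv j (ordS i) b))) (sgm (ordS i) (pos (rv j i a))) (1 - t) t01'.
have H1 : - 3 * eps <= - phi j (ordS i) (pos (rv j (ordS i) b)) <= 3 * eps by lra.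
have H2 : 1 <= - phi j (ordS i) (pos (rv j i a)) by lra.
have H3 : (1 - (1 - t)) * - phi j (ordS i) (pos (rv j (ordS i) b)) +
   (1 - t) * - phi j (ordS i) (pos (rv j i a)) <= 3 * eps by lra.
move=> /(_ H1 H2 H3 (sgm_bound (ordS i) j (ordS i) b) (sgm_bound i j (ordS i) a)).
by have := sgm_at j (ordS i) b; lra.
Qed.

Lemma nat_le_real (a b : nat) (x : RR) : a%:R - 1/3 <= x -> x <= b%:R + 1/3 -> (a <= b)%N.
Proof.
move=> h1 h2; rewrite leqNgt; apply/negP => ab.
have : (b.+1)%:R <= a%:R :> RR by rewrite ler_nat.
by rewrite -natr1; lra.
Qed.

Lemma near_same (c x : RR) (a b : 'I_q) :
  c + a%:R - 1/3 <= x <= c + a%:R + 1/3 -> c + b%:R - 1/3 <= x <= c + b%:R + 1/3 -> a = b.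
Proof.
move=> h1 h2; apply: val_inj; apply/eqP; rewrite eqn_leq.
by apply/andP; split; apply: (@nat_le_real _ _ (x - c)); lra.
Qed.

Lemma hgt_real_le j i i' (x : RR) : hgt j i - 1 < x -> x < hgt j i' + 1 -> (i <= i')%N.
Proof.
move=> h1 h2; rewrite leqNgt; apply/negP => /(hgt_lt j); lra.
Qed.

Lemma side_right (i : 'I_m) z : i <> (2 * q)%N :> nat -> i <> (2 * q).+1 :> nat -> side i z = z.1.
Proof. by move=> /eqP /negbTE h1 /eqP /negbTE h2; rewrite /side h1 h2. Qed.

Lemma phi_window j i z : (i < 2 * q)%N -> phi j i z = z.2 - hgt j i.
Proof. by rewrite /phi => ->. Qed.

Lemma sgm_window i z : (i < 2 * q)%N -> sgm i z = z.1.
Proof. by rewrite /sgm => iq; rewrite ltn_eqF //; lia. Qed.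

(** Different rings are separated by [side] against [within]. In one ring, edges of adjacent gaps
    can meet only near the common cluster, where the radial coordinate forces a common end; other
    pairs of gaps are separated by their heights and sides. *)
Lemma meet_cc (j j' : 'I_N) (i i' : 'I_m) (a b a' b' : 'I_q) z :
  seg (pos (rv j i a)) (pos (rv j (ordS i) b)) z ->
  seg (pos (rv j' i' a')) (pos (rv j' (ordS i') b')) z ->
  j = j' /\ [\/ i = i', ordS i = i' /\ b = a' | ordS i' = i /\ b' = a].
Proof.
wlog jj : j j' i i' a b a' b' / (j <= j')%N.
  move=> H h1 h2; have [jj|/ltnW jj] := leqP j j'; first exact: H h1 h2.
  have [-> h] := H _ _ _ _ _ _ _ _ jj h2 h1; split => //.
  by case: h => [->|[]|[]]; [constructor 1|constructor 3|constructor 2].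
move=> /cedge_facts [[F1 F2 F3 F4] [F5 F6]] /cedge_facts [[G1 G2 G3 G4] [G5 G6]].
have e0 := eps_gt0; have e1 := eps_small.
have {jj} jj : j = j'.
  apply: val_inj; apply/eqP; rewrite eqn_leq jj leqNgt; apply/negP => /rad_lt.
  by have := within_side i' F4; lra.
split=> //; subst j'.
have adjacent (k k' : 'I_m) (c d : 'I_q) : ordS k = k' ->
    (- 3 * eps <= phi j (ordS k) z ->
       rad j + d%:R - 1/3 <= sgm (ordS k) z <= rad j + d%:R + 1/3) ->
    (phi j k' z <= 3 * eps -> rad j + c%:R - 1/3 <= sgm k' z <= rad j + c%:R + 1/3) ->
    phi j (ordS k) z <= 3 * eps -> - 3 * eps <= phi j k' z -> d = c.
  by move=> <- f g h1 h2; apply: near_same (f h2) (g h1).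
have [ii|ni] := eqVneq (ordS i) i'.
  by constructor 2; split => //; exact: adjacent F6 G5 _ _.
have [ii|ni'] := eqVneq (ordS i') i.
  by constructor 3; split => //; exact: adjacent G6 F5 _ _.
constructor 1; apply: val_inj; apply/eqP/negPn/negP => ii.
have rq := rqty_ge2; have rg := rad_ge j.
move: {F4 G4 F5 F6 G5 G6 adjacent} F1 F2 F3 G1 G2 G3.
wlog lt : i i' a b a' b' ni ni' ii / (i < i')%N.
  move=> H; have [lt|lt|/eqP] := ltngtP i i'; last by rewrite (negbTE ii).
    exact: (H i i' a b a' b').
  by move=> *; apply: (H i' i a' b' a b) => //; rewrite eq_sym.
have im := ltn_ord i'.
have nii : (i.+1 <> i' :> nat)%N.
  by move=> h; case/eqP: ni; apply: val_inj; rewrite val_ordS ifF //; lia.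
(* The second way for [i < i'] to be cyclically adjacent: the gap from the last corner back to
   cluster 0. *)
have nii' : ~ (i' = (2 * q).+2 :> nat /\ i = 0%N :> nat).
  case=> h k; case/eqP: ni'; apply: val_inj; rewrite val_ordS.
  by rewrite /= h eqxx k.
have [iq|iq] := ltnP i (2 * q); last first.
  have ip : i = (2 * q)%N :> nat by clear -iq im lt nii; lia.
  have ip' : i' = (2 * q).+2 :> nat by clear -iq im lt nii; lia.
  have sE' : val (ordS i') = 0%N by rewrite val_ordS ip' eqxx.
  move=> F1 F2; rewrite /side ip eqxx => F3 G1; rewrite sE' phi_window // => G2 _.
  by have := @hgt_le j 0 isT; lra.
have iSm : (i.+1 == m) = false by rewrite window_neq.
have sE : val (ordS i) = i.+1 by rewrite val_ordS iSm.
move=> F1 F2 F3 G1 G2 G3.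
rewrite phi_window // in F1.
rewrite side_right // in F3; try by move=> h; move: iq; rewrite h; clear; lia.
have Hi := hgt_ge0 j i.
have [iq'|iq'] := ltnP i' (2 * q).
  have lt' : (i.+1 < i')%N by clear -lt nii; lia.
  have F2' : phi j i.+1 z <= 3 * eps by move: F2; rewrite sE.
  rewrite phi_window in F2'; last exact: ltn_trans lt' iq'.
  rewrite phi_window // in G1.
  by have := hgt_lt j lt'; lra.
have [ip|np] := i' =P (2 * q)%N :> nat.
  have lt' : (i.+1 < 2 * q)%N by clear -iq nii ip; lia.
  have F2' : phi j i.+1 z <= 3 * eps by move: F2; rewrite sE.
  rewrite phi_window // in F2'.
  by move: G3; rewrite /side ip eqxx; have := hgt_le j lt'; lra.
have [ip'|np'] := i' =P (2 * q).+1 :> nat.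
  by move: G3; rewrite /side ip' !cornerE eqxx; lra.
have ip : i' = (2 * q).+2 :> nat by clear -im iq' np np'; lia.
have i0 : (0 < i)%N by rewrite lt0n; apply/eqP => h; exact: nii'.
have sE' : val (ordS i') = 0%N by rewrite val_ordS ip eqxx.
have G2' : phi j 0 z <= 3 * eps by move: G2; rewrite sE'.
rewrite phi_window // in G2'.
by have := hgt_lt j i0; lra.
Qed.

Lemma ord_max_real : (ord_max : 'I_q)%:R = rqty - 1 :> RR.
Proof. by rewrite /rqty /= -[in RHS]natr1 addrK. Qed.

Lemma ledge_facts (j j' : 'I_N) (i : 'I_m) z : val j' = j.+2 -> (i < 2 * q)%N ->
  seg (pos (rv j i ord_max)) (pos (rv j' i ord0)) z ->
  [/\ hgt j i - eps <= z.2, z.2 <= hgt j i + eps,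
      rad j + rqty - 1 - eps <= z.1 & z.1 <= rad j' + eps].
Proof.
move=> jj iq [t t01 ->].
have := pos_near (rv j i ord_max); have := pos_near (rv j' i ord0).
rewrite /nominal iq ord_max_real => -[] /= a1 a2 a3 a4 [] /= b1 b2 b3 b4.
have hh : hgt j' i = hgt j i by rewrite -(hgtSS j) -jj.
have rr : rad j + rqty + 3 <= rad j' by apply: rad_lt; rewrite jj; exact: leqnSn.
have e1 := eps_small; have e0 := eps_gt0.
by split; (apply: lin_ge || apply: lin_le) => //; lra.
Qed.

Lemma spoke_ring (t : 'I_p) (j : 'I_N) :
  (j = 2 * r * t :> nat)%N \/ (j = (2 * r * t).+1 :> nat)%N ->
  rad (2 * r * t)%N <= rad j /\ rad j <= rad (2 * r * t)%N + rqty + 3.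
Proof.
by have rq := rqty_ge2; case=> ->; rewrite ?radS; split; lra.
Qed.

Lemma sedge_height (t : 'I_p) (j : 'I_N) (b : bool) (a : 'I_q) z :
  (j = 2 * r * t :> nat)%N \/ (j = (2 * r * t).+1 :> nat)%N ->
  seg (pos (sv t)) (pos (rv j (top_corner b) a)) z ->
  if val j == (2 * r * t)%N then rad j - eps <= z.2 <= rad j + rqty + 1 + eps
  else rad (2 * r * t)%N + rqty + 1 - eps <= z.2 <= rad j + rqty - 1 + eps.
Proof.
move=> jt [s s01 ->].
have e0 := eps_gt0; have [a0 a1] := ord_real a.
have [_ _] := pos_near (sv t); rewrite /nominal /=.
have [h1 h2] : rad j + a%:R - eps <= (pos (rv j (top_corner b) a)).2 /\
    (pos (rv j (top_corner b) a)).2 <= rad j + a%:R + eps.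
  have [_ _] := pos_near (rv j (top_corner b) a); rewrite /nominal /=.
  by case: (b); rewrite ?cornerE ?ltnn ?eqxx /=; lra.
move: (pos (sv t)).2 (pos (rv j (top_corner b) a)).2 h1 h2 => y1 y2 h1 h2 k1 k2.
case: jt => jt.
  rewrite -jt eqxx; rewrite -jt in k1 k2; clear jt.
  by apply/andP; split; [apply: lin_ge => //; lra|apply: lin_le => //; lra].
have -> : (val j == 2 * r * t)%N = false by rewrite /= jt; clear; lia.
have : rad j = rad (2 * r * t)%N + rqty + 3 by rewrite jt radS.
move: (rad j) (rad _) h1 h2 k1 k2 => x1 x2 h1 h2 k1 k2 h3; clear jt.
have e1 := eps_small.
by apply/andP; split; [apply: lin_ge => //; lra|apply: lin_le => //; lra].
Qed.

(** At its corner, an edge at [s_t] satisfies the same inequalities as a cluster edge along the top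
    side. As [s_t] has nominal abscissa 0, the edge also stays in the half-plane of its corner up to
    [eps]. *)
Lemma sedge_facts (t : 'I_p) (j : 'I_N) (b : bool) (a : 'I_q) z :
  (j = 2 * r * t :> nat)%N \/ (j = (2 * r * t).+1 :> nat)%N ->
  seg (pos (sv t)) (pos (rv j (top_corner b) a)) z ->
  if b then
    [/\ - 3 * eps <= phi j (2 * q) z, - eps <= z.1 &
        phi j (2 * q) z <= 3 * eps ->
          rad j + a%:R - 1/3 <= sgm (2 * q) z <= rad j + a%:R + 1/3]
  else
    [/\ phi j (2 * q).+1 z <= 3 * eps, z.1 <= eps &
        - 3 * eps <= phi j (2 * q).+1 z ->
          rad j + a%:R - 1/3 <= sgm (2 * q).+1 z <= rad j + a%:R + 1/3].
Proof.
move=> jt [s s01 ->].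
have e0 := eps_gt0; have rq := rqty_ge2; have [a0 a1] := ord_real a.
have pt := phi_at j (top_corner b) a; have gt := sgm_at j (top_corner b) a.
have gb := sgm_bound (top_corner b) j (top_corner b) a.
have x1 : if b then 0 <= (pos (rv j (top_corner b) a)).1
          else (pos (rv j (top_corner b) a)).1 <= 0.
  have := pos_near (rv j (top_corner b) a); rewrite /nominal /=.
  have := rad_ge j; have := eps_small.
  by case: (b); rewrite ?cornerE ?ltnn ?eqxx => ? ? [] /=; lra.
have [s1 s2 s3 s4] := pos_near (sv t); rewrite /nominal /= !subr0 in s1 s2 s3 s4.
have y0 : 1 + 2 * eps <= (pos (sv t)).2.
  have := rad_ge (2 * r * t)%N; have := eps_small; lra.
have yN : (pos (sv t)).2 <= rad N.
  have : rad (2 * r * t)%N + rqty + 3 <= rad N.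
    by apply: rad_lt; apply: ltnW; exact: sring_lt.
  by have := eps_small; lra.
have ps : if b then 1 <= phi j (2 * q) (pos (sv t)) else phi j (2 * q).+1 (pos (sv t)) <= -1.
  by case: (b); rewrite /phi ?cornerE ?ltnn ?eqxx; clear -adm r0 p0 y0 s1 s2 e0; lra.
have gs : - 2 * rad N <= sgm (top_corner b) (pos (sv t)) <= 2 * rad N.
  by rewrite /sgm; case: ifP => _; clear -adm r0 p0 y0 yN s1 s2 e0; lra.
have s01' : 0 <= 1 - s <= 1 by clear -adm r0 p0 s01; lra.
case: b pt gt gb ps gs x1 => /= pt gt gb ps gs x1.
  move: pt gt gb ps gs x1; set P := pos (inl _) => pt gt gb ps gs x1.
  split.
  - rewrite phi_lin; apply: lin_ge => //; last by case/andP: pt.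
    by clear -adm r0 p0 ps e0; lra.
  - apply: lin_ge => //; clear -adm r0 p0 x1 e0; lra.
  - rewrite phi_lin sgm_lin; move: (phi _ _ _) (phi _ _ _) (sgm _ _) (sgm _ _) pt gt gb ps gs.
    move=> f1 f2 g1 g2 pt gt gb ps gs h.
    have h' : (1 - (1 - s)) * f2 + (1 - s) * f1 <= 3 * eps by clear -adm r0 p0 h; lra.
    have := near_end s01' pt ps h' gb gs; have e1 := eps_small.
    by clear -adm r0 p0 gt e0 e1; lra.
move: pt gt gb ps gs x1; set P := pos (inl _) => pt gt gb ps gs x1.
split.
- rewrite phi_lin; apply: lin_le => //; last by case/andP: pt.
  by clear -adm r0 p0 ps e0; lra.
- apply: lin_le => //; clear -adm r0 p0 x1 e0; lra.
- rewrite phi_lin sgm_lin; move: (phi _ _ _) (phi _ _ _) (sgm _ _) (sgm _ _) pt gt gb ps gs.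
  move=> f1 f2 g1 g2 pt gt gb ps gs h.
  have h' : (1 - (1 - s)) * - f2 + (1 - s) * - f1 <= 3 * eps by clear -adm r0 p0 h; lra.
  have pt' : - 3 * eps <= - f2 <= 3 * eps by clear -adm r0 p0 pt; lra.
  have ps' : 1 <= - f1 by clear -adm r0 p0 ps; lra.
  have := near_end s01' pt' ps' h' gb gs; have e1 := eps_small.
  by clear -adm r0 p0 gt e0 e1; lra.
Qed.

(** Equal heights force the same window and the same parity. Successive long edges in one row are
    kept apart by the width [q - 1 >= 1] of a cluster. *)
Lemma meet_ll (j j' k k' : 'I_N) (i i' : 'I_m) z :
  val j' = j.+2 -> (i < 2 * q)%N -> val k' = k.+2 -> (i' < 2 * q)%N ->
  seg (pos (rv j i ord_max)) (pos (rv j' i ord0)) z ->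
  seg (pos (rv k i' ord_max)) (pos (rv k' i' ord0)) z ->
  rv j i ord_max = rv k i' ord_max.
Proof.
wlog jk : j j' k k' i i' / (j <= k)%N.
  move=> H *; have [jk|/ltnW jk] := leqP j k; first exact: (H j j' k k').
  by apply/esym; exact: (H k k' j j').
move=> jj iq kk iq' /(ledge_facts jj iq) [F1 F2 F3 F4] /(ledge_facts kk iq') [G1 G2 G3 G4].
have e0 := eps_gt0; have e1 := eps_small; have rq := rqty_ge2.
have [h1 h2] : (2 * i + odd j <= 2 * i' + odd k)%N /\ (2 * i' + odd k <= 2 * i + odd j)%N.
  by split; rewrite leqNgt; apply/negP => h; have := h; rewrite -(ler_nat RR) -natr1;
     move: F1 F2 G1 G2; rewrite /hgt; lra.
have ii : i = i'.
  by apply: val_inj => /=; clear -adm r0 p0 h1 h2; case: (odd j) h1 h2; case: (odd k); lia.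
subst i'; have oo : odd j = odd k.
  by clear -adm r0 p0 h1 h2; case: (odd j) h1 h2; case: (odd k) => //; lia.
move: jk; rewrite leq_eqVlt => /orP[/eqP/val_inj -> //|jk].
have jk' : (j' <= k)%N.
  rewrite jj ltn_neqAle jk andbT; apply/eqP => h.
  by move: oo; rewrite -h /=; case: (odd j).
have : rad j' <= rad k.
  by move: jk'; rewrite leq_eqVlt => /orP[/eqP -> //|/rad_lt]; lra.
by move=> h; exfalso; clear -adm r0 p0 F4 G3 h e0 e1 rq; lra.
Qed.

(** Long edges stay below height [4 * q], edges at [s_t] above it. *)
Lemma meet_ls (j j' k : 'I_N) (i : 'I_m) (t : 'I_p) (b : bool) (a : 'I_q) z :
  val j' = j.+2 -> (i < 2 * q)%N ->
  (k = 2 * r * t :> nat)%N \/ (k = (2 * r * t).+1 :> nat)%N ->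
  seg (pos (rv j i ord_max)) (pos (rv j' i ord0)) z ->
  ~ seg (pos (sv t)) (pos (rv k (top_corner b) a)) z.
Proof.
move=> jj iq kt /(ledge_facts jj iq) [F1 F2 F3 F4] /(sedge_height kt).
have e0 := eps_gt0; have e1 := eps_small; have rq := rqty_ge2; have h := hgt_le j iq.
have := rad_ge k; have := rad_ge (2 * r * t)%N.
by case: ifP => _; lra.
Qed.

Lemma meet_ss (t t' : 'I_p) (j j' : 'I_N) (b b' : bool) (a a' : 'I_q) z :
  (j = 2 * r * t :> nat)%N \/ (j = (2 * r * t).+1 :> nat)%N ->
  (j' = 2 * r * t' :> nat)%N \/ (j' = (2 * r * t').+1 :> nat)%N ->
  seg (pos (sv t)) (pos (rv j (top_corner b) a)) z ->
  seg (pos (sv t')) (pos (rv j' (top_corner b') a')) z -> t = t'.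
Proof.
wlog tt : t t' j j' b b' a a' / (t <= t')%N.
  move=> H *; have [h|/ltnW h] := leqP t t'; first exact: (H t t' j j' b b' a a').
  by apply/esym; exact: (H t' t j' j b' b a' a).
move=> jt jt' /(sedge_height jt) F /(sedge_height jt') G.
move: tt; rewrite leq_eqVlt => /orP[/eqP/val_inj //|tt].
have lt : ((2 * r * t).+1 < 2 * r * t')%N.
  have h : (2 * r * t.+1 <= 2 * r * t')%N by rewrite leq_mul2l tt orbT.
  by apply: leq_trans h; rewrite mulnS; clear -r0; lia.
have := rad_lt lt; rewrite radS.
have [] := spoke_ring jt; have [] := spoke_ring jt'.
have e0 := eps_gt0; have e1 := eps_small; have rq := rqty_ge2.
by move=> ? ? ? ? ?; exfalso; move: F G; case: ifP => _; case: ifP => _; lra.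
Qed.

Lemma window_hit (j : 'I_N) (i k : 'I_m) (a b : 'I_q) z :
  seg (pos (rv j i a)) (pos (rv j (ordS i) b)) z ->
  (k < 2 * q)%N -> hgt j k - eps <= z.2 -> z.2 <= hgt j k + eps -> 0 <= z.1 ->
  (i = k /\ rad j + a%:R - 1/3 <= z.1 <= rad j + a%:R + 1/3) \/
  (ordS i = k /\ rad j + b%:R - 1/3 <= z.1 <= rad j + b%:R + 1/3).
Proof.
move=> /cedge_facts [[F1 F2 F3 _] [F5 F6]] kq z1 z2 x0.
have e0 := eps_gt0; have e1 := eps_small; have rg := rad_ge j; have rq := rqty_ge2.
have hk := hgt_le j kq; have hk0 := hgt_ge0 j k; have im := ltn_ord i.
have [ik|ik] := eqVneq i k.
  left; split=> //; rewrite ik phi_window // sgm_window // in F5.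
  by apply: F5; clear F6; lra.
have [Sik|Sik] := eqVneq (ordS i) k.
  right; split=> //; rewrite Sik phi_window // sgm_window // in F6.
  by apply: F6; clear F5; lra.
exfalso; clear F5 F6.
have [ip|np] := i =P (2 * q)%N :> nat.
  by move: F3; rewrite /side ip eqxx; lra.
have [ip'|np'] := i =P (2 * q).+1 :> nat.
  by move: F3; rewrite /side ip' !cornerE eqxx; lra.
have [iq|iq] := ltnP i (2 * q).
  have sE : val (ordS i) = i.+1 by rewrite val_ordS window_neq.
  rewrite phi_window // in F1.
  have lt : (i <= k)%N by apply: (@hgt_real_le j _ _ z.2); lra.
  have lt' : (i < k)%N by rewrite ltn_neqAle lt andbT.
  have lt2 : (i.+1 < k)%N.
    rewrite ltn_neqAle lt' andbT; apply/eqP => h; case/eqP: Sik.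
    by apply: val_inj; rewrite sE.
  move: F2; rewrite sE phi_window; last exact: ltn_trans lt2 kq.
  by have := hgt_lt j lt2; lra.
have ip : val i = (2 * q).+2 by move: im iq np np'; clear => /=; lia.
have sE : val (ordS i) = 0%N by rewrite val_ordS ip eqxx.
have k0 : (0 < k)%N.
  by rewrite lt0n; apply/eqP => h; case/eqP: Sik; apply: val_inj; rewrite sE; exact: esym.
by move: F2; rewrite sE phi_window //; have := hgt_lt j k0; lra.
Qed.

(** Rings before [j] lie too far in and rings after [j'] too far out. In ring [j.+1] the height
    selects the gap; in the rings [j] and [j'] of its ends, [window_hit] produces a common end. *)
Lemma meet_lc (j j' j1 : 'I_N) (i i1 : 'I_m) (a b : 'I_q) z :
  val j' = j.+2 -> (i < 2 * q)%N ->
  seg (pos (rv j i ord_max)) (pos (rv j' i ord0)) z ->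
  seg (pos (rv j1 i1 a)) (pos (rv j1 (ordS i1) b)) z ->
  [\/ val j1 = j.+1 /\ (if odd j then i1 = i else ordS i1 = i),
      rv j i ord_max = rv j1 i1 a \/ rv j i ord_max = rv j1 (ordS i1) b |
      rv j' i ord0 = rv j1 i1 a \/ rv j' i ord0 = rv j1 (ordS i1) b].
Proof.
move=> jj iq /(ledge_facts jj iq) [D1 D2 D3 D4] sc.
have e0 := eps_gt0; have e1 := eps_small; have rq := rqty_ge2.
have rg := rad_ge j; have rg1 := rad_ge j1; have hi := hgt_le j iq; have hi0 := hgt_ge0 j i.
have x0 : 0 <= z.1 by lra.
have [lt|lt|eq] := ltngtP j1 j.
- exfalso; have [[_ _ _ [X _ _]] _] := cedge_facts sc; have := rad_lt lt; lra.
- have [lt'|lt'|eq'] := ltngtP j1 j'.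
  + have j1E : val j1 = j.+1 by move: lt lt' jj => /=; clear; lia.
    constructor 1; split => //.
    have [[F1 F2 F3 _] _] := cedge_facts sc.
    have hb : if odd j then hgt j1 i + 1 = hgt j i else hgt j i + 1 = hgt j1 i.
      by have := hgt_between j i; rewrite j1E.
    have hb' k : if odd j then hgt j1 k + 1 = hgt j k else hgt j k + 1 = hgt j1 k.
      by have := hgt_between j k; rewrite j1E.
    have im := ltn_ord i1.
    have [ip|np] := i1 =P (2 * q)%N :> nat.
      by exfalso; move: F3; rewrite /side ip eqxx; clear -adm r0 p0 rg1 rq D2 hi e0 e1; lra.
    have [ip'|np'] := i1 =P (2 * q).+1 :> nat.
      by exfalso; move: F3; rewrite /side ip' !cornerE eqxx;
        clear -adm r0 p0 rg1 rq D1 x0 hi0 e0 e1; lra.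
    (* The gap from the last corner to cluster 0 is reached only by the lowest long edge of an even
       ring. *)
    have [iq1|iq1] := ltnP i1 (2 * q); last first.
      have ip : val i1 = (2 * q).+2 by move: im iq1 np np'; clear => /=; lia.
      have sE : val (ordS i1) = 0%N by rewrite val_ordS ip eqxx.
      rewrite sE phi_window // in F2.
      have h1 := hb' 0%N; have [i0|k0] := posnP i.
        case: ifP => oj; last by apply: val_inj; rewrite sE; exact: esym.
        by exfalso; rewrite oj in h1; rewrite i0 in D1; clear -adm r0 p0 D1 F2 h1 e0 e1; lra.
      by exfalso; have := hgt_lt j k0; case: (odd j) h1 => h1; lra.
    have sE : val (ordS i1) = i1.+1 by rewrite val_ordS window_neq.
    rewrite phi_window // in F1; rewrite sE in F2.
    have F2' : (i1.+1 < 2 * q)%N -> z.2 <= hgt j1 i1.+1 + 3 * eps.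
      by move=> h; move: F2; rewrite phi_window //; lra.
    have h1 := hb' i1; have h2 := hb' i1.+1.
    case: ifP => o; rewrite o in hb h1 h2.
      apply: val_inj; apply/eqP; rewrite eqn_leq; apply/andP; split.
        by apply: (@hgt_real_le j _ _ (z.2 + 1/2)); lra.
      have [l|l] := ltnP i1.+1 (2 * q); last by move: l iq; clear => /=; lia.
      rewrite -ltnS ltn_neqAle; apply/andP; split.
        by apply/eqP => h; have := F2' l; move: h => /= h; rewrite -h; lra.
      by apply: (@hgt_real_le j _ _ z.2); have := F2' l; lra.
    apply: val_inj; rewrite sE; apply/eqP; rewrite eqn_leq; apply/andP; split.
      rewrite ltn_neqAle; apply/andP; split.
        by apply/eqP => h; move: F1; rewrite h; lra.
      by apply: (@hgt_real_le j _ _ z.2); lra.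
    have [l|l] := ltnP i1.+1 (2 * q); last by move: l iq; clear => /=; lia.
    by apply: (@hgt_real_le j _ _ (z.2 - 1/2)); have := F2' l; lra.
  + exfalso; have [[_ _ F3 _] _] := cedge_facts sc.
    move: F3; have := rad_lt lt'; have := rad_ge j'; rewrite /side.
    by case: ifP => _; [|case: ifP => _]; lra.
  + constructor 3; have jE : j' = j1 by apply/val_inj.
    subst j1; have hh : hgt j' i = hgt j i by rewrite -(hgtSS j) -jj.
    rewrite -hh in D1 D2.
    have [[ik hz]|[ik hz]] := window_hit sc iq D1 D2 x0; [left|right].
      have -> : a = ord0 :> 'I_q; last by rewrite ik.
      by apply/val_inj/eqP; rewrite -leqn0; apply: (@nat_le_real _ _ (z.1 - rad j')) => /=; lra.
    have -> : b = ord0 :> 'I_q; last by rewrite ik.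
    by apply/val_inj/eqP; rewrite -leqn0; apply: (@nat_le_real _ _ (z.1 - rad j')) => /=; lra.
- constructor 2; have jE : j1 = j by apply/val_inj.
  subst j1; have om := ord_max_real.
  have [[ik hz]|[ik hz]] := window_hit sc iq D1 D2 x0; [left|right].
    have -> : a = ord_max :> 'I_q; last by rewrite ik.
    apply/val_inj/eqP; rewrite eqn_leq -ltnS ltn_ord /=.
    by apply: (@nat_le_real _ _ (z.1 - rad j)); rewrite ?om; lra.
  have -> : b = ord_max :> 'I_q; last by rewrite ik.
  apply/val_inj/eqP; rewrite eqn_leq -ltnS ltn_ord /=.
  by apply: (@nat_le_real _ _ (z.1 - rad j)); rewrite ?om; lra.
Qed.

Lemma meet_sc (t : 'I_p) (j j1 : 'I_N) (c : bool) (i1 : 'I_m) (a0 a b : 'I_q) z :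
  (j = 2 * r * t :> nat)%N \/ (j = (2 * r * t).+1 :> nat)%N ->
  seg (pos (sv t)) (pos (rv j (top_corner c) a0)) z ->
  seg (pos (rv j1 i1 a)) (pos (rv j1 (ordS i1) b)) z ->
  [\/ j1 = j /\ i1 = top_corner true,
      rv j (top_corner c) a0 = rv j1 i1 a |
      rv j (top_corner c) a0 = rv j1 (ordS i1) b].
Proof.
move=> jt ss sc.
have S1 := sedge_height jt ss; have S2 := sedge_facts jt ss.
have [[F1 F2 F3 F4] [F5 F6]] := cedge_facts sc.
have e0 := eps_gt0; have e1 := eps_small; have rq := rqty_ge2.
have rg := rad_ge j; have rgt := rad_ge (2 * r * t)%N.
have yt : 4 * rqty + 3 <= z.2 by move: S1; case: ifP => _; clear -adm r0 p0 rg rgt rq e0 e1; lra.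
(* An edge at [s_t] stays, up to [3 * eps], in the sector where [z.2] attains the gauge. *)
have sd : side i1 z <= z.2 + 3 * eps.
  clear S1 F1 F2 F3 F4 F5 F6; rewrite /side; case: ifP => _; first by lra.
  by move: S2; rewrite /phi ltnn !cornerE !eqxx; case: (c) => -[X1 X2 _]; case: ifP => _; lra.
have jE : j1 = j.
  clear F1 F2 F5 F6; have Fy : z.2 <= rad j1 + rqty - 1 + 3 * eps by case: F4.
  clear F4 ss sc S2.
  apply: val_inj; have [lt|lt|//] := ltngtP j1 j; exfalso.
    case: jt S1 => jt; first by (have -> : (val j == 2 * r * t)%N by apply/eqP);
      have := rad_lt lt; clear jt; lra.
    have -> : (val j == 2 * r * t)%N = false by rewrite /= jt; clear; lia.
    move: lt; rewrite jt ltnS leq_eqVlt => /orP[/eqP <-|/rad_lt]; lra.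
  have := rad_lt lt.
  case: jt S1 => jt; first by (have -> : (val j == 2 * r * t)%N by apply/eqP); clear jt; lra.
  have -> : (val j == 2 * r * t)%N = false by rewrite /= jt; clear; lia.
  by lra.
subst j1; clear S1 F4 sd.
have im := ltn_ord i1.
have [ip|np] := i1 =P (2 * q)%N :> nat.
  by constructor 1; split => //; apply: val_inj.
have [ip|np'] := i1 =P (2 * q).+1 :> nat.
  case: c S2 ss => -[X1 X2 X3] ss.
    by exfalso; move: F3; rewrite /side ip !cornerE eqxx; clear -adm r0 p0 rg rq yt X2 e0 e1; lra.
  constructor 2; rewrite ip in F1 F5.
  have -> : a0 = a by apply: near_same (X3 F1) (F5 X1).
  by congr (inl (_, _, _)); apply: val_inj.
rewrite side_right // in F3.
have [iq|iq] := ltnP i1 (2 * q); last first.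
  have ip : val i1 = (2 * q).+2 by move: im iq np np'; clear => /=; lia.
  have sE : val (ordS i1) = 0%N by rewrite val_ordS ip eqxx.
  exfalso; rewrite sE phi_window // in F2.
  by have := @hgt_le j 0 isT; clear -adm r0 p0 F2 rq yt e0 e1; lra.
have sE : val (ordS i1) = i1.+1 by rewrite val_ordS window_neq.
rewrite sE in F2 F6.
have [iq'|iq'] := ltnP i1.+1 (2 * q).
  exfalso; rewrite phi_window // in F2.
  by have := hgt_le j iq'; clear -adm r0 p0 F2 rq yt e0 e1; lra.
have ip : i1.+1 = (2 * q)%N by apply/eqP; rewrite (last_window iq iq').
rewrite ip in F2 F6.
case: c S2 ss => -[X1 X2 X3] ss.
  constructor 3; have -> : a0 = b by apply: near_same (X3 F2) (F6 X1).
  by congr (inl (_, _, _)); apply: val_inj; rewrite sE ip.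
by exfalso; clear -adm r0 p0 rg rq X2 F3 e0 e1; lra.
Qed.
Lemma meet_cross u v u' v' z : arc u v -> arc u' v' -> vdisjoint u v u' v' ->
  seg (pos u) (pos v) z -> seg (pos u') (pos v') z ->
  cross_kind u v u' v' \/ cross_kind u' v' u v.
Proof.
have LC w1 w2 w1' w2' (j j' j1 : 'I_N) (i i1 : 'I_m) (a b : 'I_q) :
    val j' = j.+2 -> (i < 2 * q)%N -> w1 = rv j i ord_max -> w2 = rv j' i ord0 ->
    w1' = rv j1 i1 a -> w2' = rv j1 (ordS i1) b ->
    vdisjoint w1 w2 w1' w2' -> seg (pos w1) (pos w2) z -> seg (pos w1') (pos w2') z ->
    cross_kind w1 w2 w1' w2'.
  move=> jj iq -> -> -> -> [d1 d2 d3 d4] h1 h2.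
  case: (meet_lc jj iq h1 h2) => [[j1E iE]|[]//|[]//].
  exact: (@CrossLC _ _ _ _ j j' j1 i i1 a b).
have SC w1 w2 w1' w2' t j c a0 j1 i1 (a b : 'I_q) : spoke_rings t j ->
    w1 = sv t -> w2 = rv j (top_corner c) a0 ->
    w1' = rv j1 i1 a -> w2' = rv j1 (ordS i1) b ->
    vdisjoint w1 w2 w1' w2' -> seg (pos w1) (pos w2) z -> seg (pos w1') (pos w2') z ->
    cross_kind w1 w2 w1' w2'.
  move=> jt -> -> -> -> [_ _ d1 d2] h1 h2.
  case: (meet_sc jt h1 h2) => [[jE iE]|//|//]; subst j1 i1.
  apply: (@CrossSC _ _ _ _ t j c a0 a b) => //; rewrite ordS_top in d2.
  by case: c d1 d2 {h1 h2} => d1 d2; apply/eqP => h; [apply: d1|apply: d2]; rewrite h.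
move=> /arcP k /arcP k' dis s s'.
case: k (k) => [j i a b uE vE|j j' i jj iq uE vE|t j c a jt uE vE] k;
  case: k' => [j1 i1 a1 b1 uE' vE'|j1 j1' i1 jj1 iq1 uE' vE'|t1 j1 c1 a1 jt1 uE' vE'].
- left; move: (dis) s s'; rewrite uE vE uE' vE' => -[d1 d2 d3 d4] s s'.
  have [jE [iE|[iE bE]|[iE bE]]] := meet_cc s s'; subst j1.
  + subst i1; apply: (@CrossCC _ _ _ _ j i a b a1 b1) => //.
      by apply/eqP => h; apply: d1; rewrite h.
    by apply/eqP => h; apply: d4; rewrite h.
  + by case: d3; rewrite iE bE.
  + by case: d2; rewrite iE bE.
- by right; apply: (LC _ _ _ _ j1 j1' j i1 i a b) => //; exact: vdisjointC.
- by right; apply: (SC _ _ _ _ t1 j1 c1 a1 j i a b) => //; exact: vdisjointC.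
- by left; apply: (LC _ _ _ _ j j' j1 i i1 a1 b1).
- case: dis => d _ _ _; case: d; move: s s'; rewrite uE vE uE' vE' => s s'.
  exact: (meet_ll jj iq jj1 iq1 s s').
- by exfalso; move: s s'; rewrite uE vE uE' vE'; exact: (meet_ls jj iq jt1).
- by left; apply: (SC _ _ _ _ t j c a j1 i1 a1 b1).
- by exfalso; move: s' s; rewrite uE vE uE' vE'; exact: (meet_ls jj1 iq1 jt).
- case: dis => d _ _ _; case: d; move: s s'; rewrite uE vE uE' vE' => s s'.
  by rewrite (meet_ss jt jt1 s s').
Qed.

(** The meeting lemmas are reused: [v] is an end of cluster edges in the gaps on both sides of it,
    or of edges at [s_t] to two rings. If [e] contains [v], it meets all of these, which is only
    possible if [v] is an end of [e]. *)
Lemma ring_off_edges (e : redge) v : seg (pos (rsrc e)) (pos (rdst e)) (pos v) ->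
  v = rsrc e \/ v = rdst e.
Proof.
have := edge_arc e; move: (rsrc e) (rdst e) => x y /arcP k s.
case: v s => [[[j' i'] a']|t'] s; last first.
  have ss (j : 'I_N) : seg (pos (sv t')) (pos (rv j (top_corner true) ord0)) (pos (sv t')).
    exact: segl.
  pose k0 : 'I_N := Ordinal (ltnW (sring_lt t')).
  pose k1 : 'I_N := Ordinal (sring_lt t').
  have h0 : spoke_rings t' k0 by left.
  have h1 : spoke_rings t' k1 by right.
  case: k s => [j i a b -> -> s|j j' i jj iq -> -> s|t j c a jt -> -> s].
  - have K (k : 'I_N) : spoke_rings t' k -> j = k.
      by move=> hk; case: (meet_sc hk (ss k) s) => [[]//|[->]|[->]].
    by have := congr1 val (etrans (esym (K _ h0)) (K _ h1)) => /=; clear; lia.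
  - by exfalso; exact: (meet_ls jj iq h0 s (ss k0)).
  - by left; rewrite (meet_ss jt h0 s (ss k0)).
have [i2 iE] := ordS_pred i'.
have sf b : seg (pos (rv j' i' a')) (pos (rv j' (ordS i') b)) (pos (rv j' i' a')).
  exact: segl.
have sg b : seg (pos (rv j' i2 b)) (pos (rv j' (ordS i2) a')) (pos (rv j' i' a')).
  by rewrite iE; exact: segr.
case: k s => [j i a b -> -> s|j j2 i jj iq -> -> s|t j c a jt -> -> s].
(* The far ends of the auxiliary edges are chosen to differ from the ends of [e], so that a common
   end must be [v]. *)
- have [b1 b1a] := other_ord a; have [b2 b2b] := other_ord b.
  have [jE [ii|[ii bE]|[ii bE]]] := meet_cc s (sf b1); subst j'.
  + have [_ [jj|[jj bE]|[jj bE]]] := meet_cc s (sg b2).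
    * by move: (ordS_neq i2); rewrite iE -ii jj eqxx.
    * by move: b2b; rewrite bE eqxx.
    * by left; rewrite -iE jj bE.
  + by right; rewrite ii bE.
  + by move: b1a; rewrite bE eqxx.
(* In the skipped ring, the long edge would pass through both gaps at [v], but it crosses only one
   gap. *)
- have [jE|nj] := eqVneq (val j') j.+1.
    have E1 : j <> j' by move=> h; move: jE; rewrite h /=; clear; lia.
    have E2 : j2 <> j' by move=> h; move: jE; rewrite -h jj /=; clear; lia.
    have H a1 i1 b1 : seg (pos (rv j' i1 a1)) (pos (rv j' (ordS i1) b1)) (pos (rv j' i' a')) ->
        if odd j then i1 = i else ordS i1 = i.
      by move=> s1; case: (meet_lc jj iq s s1) => [[]//|[][]//|[][]//].
    have := H _ _ _ (sf ord0); have := H _ _ _ (sg ord0).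
    case: ifP => _ h1 h2; exfalso; move: (ordS_neq i2); rewrite iE.
      by rewrite h1 h2 eqxx.
    by rewrite -{1}iE h1 -[X in X == _]h2; move: (ordS_neq i'); rewrite h2 -h1 iE eqxx.
  have [[h _]|[h|h]|[h|h]] := meet_lc jj iq s (sf ord0).
  + by move: nj; rewrite h eqxx.
  + by left; exact: esym.
  + by case: h.
  + by right; exact: esym.
  have [[h' _]|[h'|h']|[h'|h']] := meet_lc jj iq s (sf ord_max).
  + by move: nj; rewrite h' eqxx.
  + by left; exact: esym.
  + by case: h h' => h _ [h' _]; move: jj; rewrite h -h'; clear => /=; lia.
  + by right; exact: esym.
  + by case: h'.
- have [b1 b1a] := other_ord a.
  case: (meet_sc jt s (sf b1)) => [[jE ii]|h|h]; last 2 first.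
  + by right; exact: esym.
  + by case: h => _ _ h; move: b1a; rewrite h eqxx.
  case: (meet_sc jt s (sg b1)) => [[_ ii2]|h|h].
  + by move: (ordS_neq i2); rewrite iE ii ii2 eqxx.
  + by case: h => _ _ h; move: b1a; rewrite h eqxx.
  + by right; rewrite h iE.
Qed.

(** If [u] and [v] coincide in the plane, [v] lies on every edge that leaves [u] and so is its other
    end; but [u] has two such neighbours. *)
Lemma ring_pos_inj : injective pos.
Proof.
move=> u v uv; apply: contrapT => nuv.
have H x : arc u x -> v = x.
  move=> /arc_edge [e eu ex]; have : v = rsrc e \/ v = rdst e.
    by apply: ring_off_edges; rewrite -uv eu; exact: segl.
  by rewrite eu ex => -[/esym|].
case: u {uv nuv} H => [[[j i] a]|t] H.
  have := H _ (arcS j i a ord0); rewrite (H _ (arcS j i a ord_max)).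
  by case.
pose k0 : 'I_N := Ordinal (ltnW (sring_lt t)).
have A b : arc (sv t) (rv k0 (top_corner true) b) by rewrite /= !eqxx.
by have := H _ (A ord0); rewrite (H _ (A ord_max)) => -[].
Qed.
(** * Face-distances *)

Lemma pos_innermost (j : 'I_N) (i : 'I_m) : pos (rv j i ord0) = nominal (rv j i ord0).
Proof. by have [_ _] := adm (rv j i ord0); apply. Qed.

Local Notation curve := (straight rsrc rdst pos).

Lemma cluster_edge_drawn (j : 'I_N) (i : 'I_m) (a b : 'I_q) z :
  seg (pos (rv j i a)) (pos (rv j (ordS i) b)) z -> drawn pos curve z.
Proof.
have [e eu ev] := arc_edge (arcS j i a b).
by case=> t t01 ->; right; exists e; exists t => //; rewrite /straight eu ev.
Qed.

(* The innermost vertices are unperturbed, so the innermost polygon of each ring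
   is exactly a level set of the gauge. *)
Lemma ring_drawn (j : 'I_N) z : gauge z = rad j -> drawn pos curve z.
Proof.
have R0 : 0 < rad j by have := rad_ge j; have := rqty_ge2; lra.
have nomE (i : 'I_m) : nominal (rv j i ord0) = 
  if (i < 2 * q)%N then (rad j, hgt j i)
      else if i == 2 * q :> nat then (rad j, rad j)
      else if i == (2 * q).+1 :> nat then (- 2 * rad j, rad j)
      else (rad j, - 2 * rad j) by rewrite /nominal /= addr0.
move=> /gauge_eq [h1 h2 h3 hz].
have tE : nominal (rv j (top_corner true) ord0) = (rad j, rad j).
  by rewrite nomE /= ltnn eqxx.
have tE' : nominal (rv j (top_corner false) ord0) = (- 2 * rad j, rad j).
  by rewrite nomE /= !cornerE eqxx.
have bl : ((2 * q).+2 < m)%N by [].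
have bE : nominal (rv j (Ordinal bl) ord0) = (rad j, - 2 * rad j).
  by rewrite nomE /= !cornerE.
have Sb : ordS (top_corner false) = Ordinal bl.
  by apply: val_inj; rewrite val_ordS /= !cornerE.
case: hz => hz.
(* The ordinates of the vertices on the right side, from the lower corner through the windows to the
   upper corner. *)
- pose f k := if k is k'.+1 then (if (k' < 2 * q)%N then hgt j k' else rad j) else - 2 * rad j.
  have [||k kq hk] := @chain_cover f (2 * q).+1 z.2 => //.
    by rewrite /f ltnn h2 andbT; lra.
  case: k kq hk => [_|k kq] hk.
    apply: (@cluster_edge_drawn j (Ordinal bl) ord0 ord0).
    have -> : z = (rad j, z.2) by case: (z) hz => ? ? /= ->.
    rewrite !pos_innermost bE nomE val_ordS /= eqxx /=.
    exact: seg_vertical.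
  have km : (k < m)%N by clear -kq; lia.
  have kq' : (k < 2 * q)%N by clear -kq; lia.
  apply: (@cluster_edge_drawn j (Ordinal km) ord0 ord0).
  have -> : z = (rad j, z.2) by case: (z) hz => ? ? /= ->.
  rewrite !pos_innermost !nomE val_ordS /= kq' window_neq //.
  move: hk; rewrite /f kq'; case: ifP => kq2 hk; first exact: seg_vertical.
  have -> : (k.+1 == 2 * q)%N by apply/eqP; clear -kq2 kq'; lia.
  exact: seg_vertical.
- apply: (@cluster_edge_drawn j (top_corner true) ord0 ord0).
  rewrite !pos_innermost ordS_top tE tE'.
  exists ((rad j - z.1) / (3 * rad j)).
    by rewrite divr_ge0 /= ?ler_pdivrMr ?mulr_gt0 //; lra.
  case: z hz h1 h2 h3 => x y /= -> *; rewrite /lin /=; congr pair; field; exact: lt0r_neq0.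
- apply: (@cluster_edge_drawn j (top_corner false) ord0 ord0).
  rewrite !pos_innermost Sb tE' bE.
  exists ((2 * rad j + z.1) / (3 * rad j)).
    by rewrite divr_ge0 /= ?ler_pdivrMr ?mulr_gt0 //; lra.
  have yE : z.2 = - rad j - z.1 by lra.
  case: z hz yE h1 h2 h3 => x y /= _ -> *; rewrite /lin /=; congr pair; field; exact: lt0r_neq0.
Qed.

Lemma gauge_spoke (t : 'I_p) :
  rad (2 * r * t)%N < gauge (pos (sv t)) < rad (2 * r * t).+1.
Proof.
have [h1 h2 h3 h4] := pos_near (sv t); rewrite /nominal /= !subr0 in h1 h2 h3 h4.
have rg := rad_ge (2 * r * t)%N; have rq := rqty_ge2; have e0 := eps_gt0.
have e1 := eps_small; apply/andP; split.
  by apply: lt_le_trans (_ : (pos (sv t)).2 <= _); [lra|rewrite /gauge !le_max lexx orbT].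
by rewrite /gauge !gt_max radS; apply/and3P; split; lra.
Qed.

(** The vertices [s_t] lie strictly between consecutive levels, and [2 * r - 1] further levels at
    least separate those of one from those of another. A walk with [n < r] face-vertices is too
    short to pass them. *)
Lemma spokes_far (t t' : 'I_p) n : t != t' -> fwalk pos curve n (pos (sv t)) (pos (sv t')) ->
  (r <= n)%N.
Proof.
move=> tt' w; rewrite leqNgt; apply/negP => nr.
have incr j : rad j < rad j.+1 by rewrite radS; have := rqty_ge2; lra.
have drw j : (j < N)%N -> forall z, gauge z = rad j -> drawn pos curve z.
  by move=> jN z; exact: (@ring_drawn (Ordinal jN)).
have rle a b : (a <= b)%N -> rad a <= rad b.
  by rewrite leq_eqVlt => /orP[/eqP ->//|/rad_lt]; have := rqty_ge2; lra.
have step (s s' : 'I_p) : (s < s')%N -> (2 * r * s + 2 * r <= 2 * r * s')%N.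
  by move=> ss; rewrite -mulnSr leq_mul2l ss orbT.
have lN (s : 'I_p) : ((2 * r * s).+1 < N)%N := sring_lt s.
have /andP[a1 a2] := gauge_spoke t; have /andP[b1 b2] := gauge_spoke t'.
move: tt'; rewrite neq_ltn => /orP[lt|lt].
  have h := step _ _ lt; have l := lN t'.
  have := fwalk_outward gauge_continuous incr drw w (j := (2 * r * t).+1) _ a2.
  have h1 : ((2 * r * t).+1 + n <= 2 * r * t')%N by clear -h nr; lia.
  move=> /(_ (leq_trans h1 (ltnW (ltnW l)))) lt1.
  by have := rle _ _ h1; lra.
have h := step _ _ lt.
have h1 : ((2 * r * t').+1 <= 2 * r * t - n)%N by clear -h nr; lia.
have h2 : (n <= 2 * r * t)%N by clear -h nr; lia.
have := fwalk_inward gauge_continuous incr drw w h2 (ltnW (lN t)) a1.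
by have := rle _ _ h1; lra.
Qed.

End Position.

(** * Assembling the drawing *)

Lemma ring_graph_drawing (k : nat) : (q * q <= k)%N -> (p < 2 * q)%N ->
  exists pos : V -> plane, let curve := straight rsrc rdst pos in
  [/\ simple_graph rsrc rdst, k_plane rsrc rdst pos curve k,
      unique_min_vertex_cut rsrc rdst (spokes) &
      forall s1 s2, s1 \in spokes -> s2 \in spokes -> s1 != s2 ->
        face_dist_ge pos curve r s1 s2].
Proof.
move=> qk pq.
have sG : simple_graph rsrc rdst by exact: ring_simple.
have [pos adm nc] := generic_position eps_gt0 sG (fun pos adm => @ring_pos_inj pos adm)
  (fun pos adm => @ring_off_edges pos adm).
exists pos => curve.
have pI := ring_pos_inj adm; have pO := ring_off_edges adm.
have vdis e f : ~~ touch rsrc rdst e f -> vdisjoint (rsrc e) (rdst e) (rsrc f) (rdst f).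
  by rewrite /touch !negb_or => /and4P[/eqP ? /eqP ? /eqP ? /eqP ?]; split.
have mc e f z : e <> f -> edge_int curve e z -> edge_int curve f z ->
    may_cross (rsrc e) (rdst e) (rsrc f) (rdst f).
  move=> ef ez fz; apply: (meet_cross adm (edge_arc e) (edge_arc f)).
  - by apply: vdis; exact: (crossing_ntouch sG pI pO ef ez fz).
  - exact: edge_int_seg ez.
  - exact: edge_int_seg fz.
split=> //.
- apply: (@straight_k_plane _ _ _ _ _ sG pI pO k _
    (fun e f => cross_code (rsrc e) (rdst e) (rsrc f) (rdst f))).
  + move=> e1 e2 e3 z e12 e31 e32 z1 z2 z3.
    have t12 := crossing_ntouch sG pI pO e12 z1 z2.
    have t13 := crossing_ntouch sG pI pO (nesym e31) z1 z3.
    have t23 := crossing_ntouch sG pI pO (nesym e32) z2 z3.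
    apply: (nc e1 e2 e3 t12 t13 t23); last first.
      by exists z; split; exact: edge_int_seg.
    (* Generic position says nothing about three innermost edges, but no two of these cross: in one
       gap they share both ends, and all other crossings involve a long edge or some [s_t], which
       has an end that is not innermost. *)
    apply/negP => /and3P[/andP[f1 f2] /andP[f3 f4] _].
    case: (mc _ _ _ e12 z1 z2) => -[].
    * move=> j i a b a' b' aa _ E1 _ E2 _; move: f1 f3 aa.
      by rewrite E1 E2 /innermost => /eqP -> /eqP ->; rewrite eqxx.
    * by move=> j j' j1 i i1 a b _ _ _ [E1 _ _]; move: f1; rewrite E1.
    * by move=> t j c a0 a b _ _ E1; move: f1; rewrite E1.
    * move=> j i a b a' b' aa _ E1 _ E2 _; move: f1 f3 aa.
      by rewrite E1 E2 /innermost => /eqP -> /eqP ->; rewrite eqxx.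
    * by move=> j j' j1 i i1 a b _ _ _ [E1 _ _]; move: f3; rewrite E1.
    * by move=> t j c a0 a b _ _ E1; move: f3; rewrite E1.
  + by rewrite card_prod !card_ord.
  + move=> e f g fe ge [z ez fz] [z' ez' gz'] cE.
    have [h1 h2] := cross_code_inj (edge_arc e) (mc _ _ _ (nesym fe) ez fz)
      (mc _ _ _ (nesym ge) ez' gz') cE.
    exact: redge_eq.
- exact: spokes_unique_min.
- move=> _ _ /imsetP[t _ ->] /imsetP[t' _ ->] tt n w; apply: (spokes_far adm _ w).
  by apply: contraNneq tt => ->.
Qed.

End RingGraph.

(** * Conclusion *)

(** The middle vertex [None] is at the origin. With only two edges, triple points cannot occur and a
    single code suffices. *)
Lemma path3_drawing : exists (V E : finType) (src dst : E -> V) (pos : V -> plane),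
  simple_graph src dst /\ k_plane src dst pos (straight src dst pos) 1 /\
  exists S : {set V}, unique_min_vertex_cut src dst S /\ #|S| = 1.
Proof.
pose src := fun _ : bool => None : option bool.
pose dst := fun b : bool => Some b.
pose pos (v : option bool) : plane :=
  if v is Some b then (if b then (1, 0) else (0, 1)) else (0, 0).
have sG : simple_graph src dst.
  by split=> // e1 e2; rewrite eqxx /= => /orP[/eqP []|].
have pI : injective pos.
  by move=> [[]|] [[]|] // [] /eqP; rewrite ?oner_eq0 // eq_sym oner_eq0.
have pO : off_edges src dst pos.
  move=> e [b|] /=; last by left.
  rewrite /eseg /= => -[t _]; case: e; case: b => /=; [by right| | |by right];
    by rewrite /lin /= => -[] /eqP; rewrite !(mulr0, mulr1, addr0, oner_eq0) // => _ /eqP;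
      rewrite oner_eq0.
exists (option bool), bool, src, dst, pos; split => //; split.
  apply: (@straight_k_plane _ _ _ _ _ sG pI pO 1 unit (fun _ _ => tt)).
  - by move=> [] [] [].
  - by rewrite card_unit.
  - by move=> e f g fe ge _ _ _; case: e f g fe ge => -[] [].
have adjN b : adj src dst None (Some b).
  by apply/existsP; exists b; rewrite /src /dst !eqxx.
have cut0 T : vertex_cut src dst T -> None \in T.
  move=> [x [y [xT yT xy]]]; apply: contraNT xy => nT.
  have H v : v \notin T -> connect (del_rel src dst T) None v.
    case: v => [b|_]; last exact: connect0.
    by move=> bT; apply: connect1; rewrite /del_rel adjN nT bT.
  apply: connect_trans (H y yT); rewrite (sym_connect_sym _) ?H // => u v.
  rewrite /del_rel [X in _ && X]andbC; congr (_ && _).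
  by apply: eq_existsb => e; rewrite orbC.
have cutS : vertex_cut src dst [set None]%SET.
  exists (Some true), (Some false); split; rewrite ?inE //.
  apply/negP => /closed_connect H.
  suff /H : fingraph.closed (del_rel src dst [set None]%SET) (pred1 (Some true)) by [].
  move=> x y /and3P[/existsP[e]]; rewrite !inE /src /dst.
  by case: x y => [x|] [y|].
exists [set None]%SET; split; last exact: cards1.
split; first split=> // T /cut0 h.
  by rewrite cards1 card_gt0; apply/set0Pn; exists None.
move=> T [cT mT]; apply/eqP; rewrite eq_sym eqEcard.
rewrite (mT _ cutS) andbT; apply/fintype.subsetP => x; rewrite inE => /eqP ->.
exact: cut0.
Qed.

Theorem mainTheorem15 (k p r : nat) :
  (0 < k)%N -> (0 < p)%N -> (0 < r)%N -> (p < 2 * Nat.sqrt k)%N ->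
  exists (V E : finType) (src dst : E -> V)
         (pos : V -> plane) (curve : E -> RR -> plane),
    simple_graph src dst /\ k_plane src dst pos curve k /\
    exists S : {set V},
      unique_min_vertex_cut src dst S /\ #|S| = p /\
      (forall s1 s2, s1 \in S -> s2 \in S -> s1 != s2 ->
         face_dist_ge pos curve r s1 s2).
Proof.
move=> k0 p0 r0 pk.
have [p1|p1] := leqP p 1.
  have [V [E [src [dst [pos [sG [kG [S [uS S1]]]]]]]]] := path3_drawing.
  exists V, E, src, dst, pos, (straight src dst pos); split=> //; split.
    case: kG => d [c u]; split=> //; split=> // e.
    by have [s [s1 sP]] := c e; exists s; split=> //; exact: leq_trans s1 k0.
  exists S; split=> //; split; first by apply/eqP; rewrite S1 eqn_leq p0.
  (* The cut is a single vertex, so the distance condition is vacuous. *)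
  move/eqP/cards1P: S1 => [x ->] s1 s2 /set1P -> /set1P ->; by rewrite eqxx.
have sq : (Nat.sqrt k * Nat.sqrt k <= k)%N by have := PeanoNat.Nat.sqrt_spec' k; lia.
(* From [1 < p < 2 * Nat.sqrt k] the root is at least 2, which allows clusters of size [q0.+2]. *)
case: (Nat.sqrt k) sq pk => [|[|q0]] sq pk; [lia|lia|].
have [pos [sG kG uS far]] := ring_graph_drawing r0 p0 sq pk.
exists ('I_(2 * r * p) * 'I_(2 * q0.+2).+3 * 'I_q0.+2 + 'I_p)%type, (redge q0 r p).
exists (@rsrc q0 r p), (@rdst q0 r p), pos, (straight (@rsrc q0 r p) (@rdst q0 r p) pos).
split=> //; split=> //; exists (spokes q0 r p); split=> //; split=> //.
exact: card_spokes.
Qed.
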